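(* Let $r\ge1$ and let $V_1,\dots,V_r$ be $l$-highest weight modules in the category $\mathrm{Mod}(\mathcal U_q(\hat{\mathfrak g}))$. Consider the fusion module $W=i(V_1)\otimes_f i(V_2)\otimes_f\cdots\otimes_f i(V_r)$. Let $v_1\in V_1,\dots,v_r\in V_r$ be $l$-highest weight vectors, let $(P_i^1)_{i\in I},\dots,(P_i^r)_{i\in I}$ be the respective Drinfeld polynomials, let $v=v_1\otimes\cdots\otimes v_r\in W$, $\tilde W(v)=\mathcal U_q^u(\hat{\mathfrak g}).v$ and $(\tilde W(v))_{u=1}=\tilde W(v)/((u-1)\tilde W(v))$. Then: 1) the $\mathcal U_q(\hat{\mathfrak g})$-module $(\tilde W(v))_{u=1}\in\mathrm{Mod}(\mathcal U_q(\hat{\mathfrak g}))$ is an $l$-highest weight module with $l$-highest weight vector $v=v_1\otimes\cdots\otimes v_r$; 2) the Drinfeld polynomials of the $l$-highest weight of $(\tilde W(v))_{u=1}$ are $(P_i^1(z)P_i^2(z)\cdots P_i^r(z))_{i\in I}$.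
   Context: **Cartan data.** $C=(C_{i,j})_{1\le i,j\le n}$ is a symmetrizable generalized Cartan matrix ($C_{i,j}\in\mathbb Z$, $C_{i,i}=2$, $C_{i,j}\le 0$ for $i\neq j$, $C_{i,j}=0\Leftrightarrow C_{j,i}=0$), $I=\{1,\dots,n\}$, $D=\mathrm{diag}(r_1,\dots,r_n)$ with positive integers $r_i$ such that $B=DC$ is symmetric. $q\in\mathbb C^*$ is not a root of unity, with rational powers fixed compatibly ($q^{s+t}=q^sq^t$); $q_i=q^{r_i}$, $[l]_q=\frac{q^l-q^{-l}}{q-q^{-1}}$, and $\begin{bmatrix}s\\k\end{bmatrix}_{q_i}$ is the $q_i$-binomial coefficient. $(\mathfrak h,\{\alpha_i\},\{\alpha_i^\vee\})$ is a realization of $C$: $\mathfrak h$ is a $\mathbb Q$-vector space of dimension $2n-\mathrm{rank}(C)$, the $\alpha_i\in\mathfrak h^*$ and the $\alpha_i^\vee\in\mathfrak h$ are linearly independent families, $\alpha_j(\alpha_i^\vee)=C_{i,j}$. $P=\{\lambda\in\mathfrak h^*\mid\lambda(\alpha_i^\vee)\in\mathbb Z\ \forall i\}$, $Q^+=\sum_i\mathbb N\alpha_i$, $\mathcal S(\lambda)=\lambda-Q^+$. **Quantum affinization.** $\mathcal U_q(\hat{\mathfrak g})$ is the $\mathbb C$-algebra with generators $x_{i,r}^{\pm}$ ($i\in I,r\in\mathbb Z$), $k_h$ ($h\in\mathfrak h$), $h_{i,m}$ ($i\in I,m\in\mathbb Z\setminus\{0\}$) and relations: $k_hk_{h'}=k_{h+h'}$,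 $k_0=1$; all $k_h,h_{i,m}$ commute pairwise; $k_hx_{j,r}^{\pm}k_{-h}=q^{\pm\alpha_j(h)}x_{j,r}^{\pm}$; $h_{i,m}x_{j,r}^{\pm}-x_{j,r}^{\pm}h_{i,m}=\pm\frac1m[mB_{i,j}]_q x_{j,m+r}^{\pm}$; $x_{i,r}^+x_{j,s}^--x_{j,s}^-x_{i,r}^+=\delta_{i,j}\frac{\phi^+_{i,r+s}-\phi^-_{i,r+s}}{q_i-q_i^{-1}}$; $(w-q^{\pm B_{i,j}}z)x_i^{\pm}(z)x_j^{\pm}(w)=(q^{\pm B_{i,j}}w-z)x_j^{\pm}(w)x_i^{\pm}(z)$; and the affine quantum Serre relations: for $i\ne j$, $s=1-C_{i,j}$, $\sum_{\pi\in\Sigma_s}\sum_{k=0}^s(-1)^k\begin{bmatrix}s\\k\end{bmatrix}_{q_i}x_i^{\pm}(w_{\pi(1)})\cdots x_i^{\pm}(w_{\pi(k)})x_j^{\pm}(z)x_i^{\pm}(w_{\pi(k+1)})\cdots x_i^{\pm}(w_{\pi(s)})=0$. Here $x_i^\pm(w)=\sum_r x_{i,r}^\pm w^r$ and $\sum_{m\ge0}\phi^{\pm}_{i,\pm m}z^{\pm m}=k_{\pm r_i\alpha_i^\vee}\exp(\pm(q-q^{-1})\sum_{m\ge1}h_{i,\pm m}z^{\pm m})$, $\phi^+_{i,m}=0$ for $m<0$, $\phi^-_{i,m}=0$ for $m>0$. Convention: if $C_{i,j}C_{j,i}\le3$ for all $i\ne j$, $\mathcal U_q(\hat{\mathfrak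 g})$ denotes this algebra; otherwise it denotes the algebra defined in the same way without the affine quantum Serre relations. $\mathcal U_q(\mathfrak h)$ is the subalgebra generated by the $k_h$. $\mathcal U_q'(\hat{\mathfrak g})=\mathcal U_q(\hat{\mathfrak g})\otimes\mathbb C(u)$. **Modules.** $V_\omega=\{v\mid k_h v=q^{\omega(h)}v\ \forall h\in\mathfrak h\}$ for $\omega\in\mathfrak h^*$. $\mathrm{Mod}(\mathcal U_q(\hat{\mathfrak g}))$ is the category of $\mathcal U_q(\hat{\mathfrak g})$-modules $V=\bigoplus_\omega V_\omega$ with all $V_\omega$ finite dimensional, all weights in a finite union $\bigcup_j\mathcal S(\lambda_j)$, and such that for all $\omega,i$ there is $R\ge0$ with $V_{\omega\pm r\alpha_i}=\{0\}$ for $r\ge R$. An $l$-weight is a couple $(\lambda,\Psi)$, $\lambda\in P$, $\Psi=(\Psi^\pm_{i,\pm m})_{i\in I,m\ge0}$, $\Psi^\pm_{i,\pm m}\in\mathbb C$, $\Psi^\pm_{i,0}=q_i^{\pm\lambda(\alpha_i^\vee)}$. $V$ is of $l$-highest weight $(\lambda,\Psi)$ if there is $v\in V_\lambda$ ($l$-highest weight vector) with $V=\mathcal U_q(\hat{\mathfrak g}).v$, $x^+_{i,r}v=0$, $\phi^\pm_{i,\pm m}v=\Psi^\pm_{i,\pm m}v$ for all $i\in I,r\in\mathbb Z,m\ge0$. $(\lambda,\Psi)$ is dominant if there are (Drinfeld) polynomials $P_i\in\mathbb C[z]$, $P_i(0)=1$, with $\sum_{m\ge0}\Psi^\pm_{i,\pm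 m}z^{\pm m}=q_i^{\deg P_i}\frac{P_i(zq_i^{-1})}{P_i(zq_i)}$ in $\mathbb C[[z]]$ (resp. $\mathbb C[[z^{-1}]]$). The $l$-highest weight of an $l$-highest weight module in $\mathrm{Mod}(\mathcal U_q(\hat{\mathfrak g}))$ is dominant. **Fusion.** $\Delta_u:\mathcal U'_q(\hat{\mathfrak g})\to(\mathcal U_q(\hat{\mathfrak g})\otimes_{\mathbb C}\mathcal U_q(\hat{\mathfrak g}))((u))$ is the $\mathbb C(u)$-algebra morphism with $\Delta_u(x^+_{i,r})=x^+_{i,r}\otimes1+\sum_{s\ge0}u^{r+s}(\phi^-_{i,-s}\otimes x^+_{i,r+s})$, $\Delta_u(x^-_{i,r})=u^r(1\otimes x^-_{i,r})+\sum_{s\ge0}u^s(x^-_{i,r-s}\otimes\phi^+_{i,s})$, $\Delta_u(\phi^\pm_{i,\pm m})=\sum_{0\le s\le m}u^{\pm s}(\phi^\pm_{i,\pm(m-s)}\otimes\phi^\pm_{i,\pm s})$, $\Delta_u(k_h)=k_h\otimes k_h$. For $V\in\mathrm{Mod}(\mathcal U_q(\hat{\mathfrak g}))$, $i(V)=V\otimes_{\mathbb C}\mathbb C(u)$. The fusion module $i(V_1)\otimes_f\cdots\otimes_f i(V_r)$ is the $\mathbb C(u)$-vector space $(V_1\otimes_{\mathbb C}\cdots\otimes_{\mathbb C}V_r)\otimes\mathbb C(u)$ with the $\mathcal U'_q(\hat{\mathfrak g})$-action defined inductively, as $i(V_1)\otimes_f(i(V_2)\otimes_f\cdots\otimes_f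 i(V_r))$, by $g.(w_1\otimes w')=\Delta_u(g)(w_1\otimes w')$ (the power series in $u$ obtained are expansions of elements of the $\mathbb C(u)$-vector space; the bracketing is irrelevant provided that for a first factor which is a fusion of $a$ modules one uses $\Delta_{u^a}$, i.e. $u$ replaced by $u^a$). $\mathcal A=\{f/g\mid f,g\in\mathbb C[u^\pm],g(1)\ne0\}\subset\mathbb C(u)$, $\mathcal U_q^u(\hat{\mathfrak g})=\mathcal U_q(\hat{\mathfrak g})\otimes_{\mathbb C}\mathcal A$. *)

(* Defs.v *)
From HB Require Import structures.
From mathcomp Require Import all_boot all_order all_algebra.
From mathcomp Require Import generic_quotient ring_quotient fraction.
From mathcomp Require Import boolp reals complex.
From mathcomp Require Import perm finmap monalg.

Set Implicit Arguments.
Unset Strict Implicit.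
Unset Printing Implicit Defensive.

Import Order.TTheory GRing.Theory Num.Theory.
Local Open Scope ring_scope.
Local Open Scope quotient_scope.

Record submodule (K : pzRingType) (M : lmodType K) := Submodule {
  submod_mem :> M -> Prop;
  submod0 : submod_mem 0;
  submodD : forall x y, submod_mem x -> submod_mem y -> submod_mem (x + y);
  submodZ : forall k x, submod_mem x -> submod_mem (k *: x)
}.

Section SubQuot.
Variables (K : pzRingType) (M : lmodType K) (N : submodule M).

Definition submod_pred : {pred M} := fun x => `[< N x >].

Lemma submod_predE x : (x \in submod_pred) = `[< N x >]. Proof. by []. Qed.

Lemma submod_pred_closed : subsemimod_closed submod_pred.
Proof.
split; first split.
- by apply/asboolP; apply: submod0.
- by move=> x y /asboolP Nx /asboolP Ny; apply/asboolP; apply: submodD.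
- by move=> k x /asboolP Nx; apply/asboolP; apply: submodZ.
Qed.

HB.instance Definition _ :=
  GRing.isSubmodClosed.Build K M submod_pred submod_pred_closed.

Record subspace := Subspace { subspace_val : M; _ : subspace_val \in submod_pred }.

HB.instance Definition _ := [isSub for subspace_val].
HB.instance Definition _ := [Choice of subspace by <:].
HB.instance Definition _ := [SubChoice_isSubLmodule of subspace by <:].

Definition lquot : Type := Quotient.quot submod_pred.
HB.instance Definition _ := GRing.Zmodule.on lquot.

Definition lquot_pi (x : M) : lquot := \pi_(Quotient.quot submod_pred) x.

Lemma lquot_piP x y : lquot_pi x = lquot_pi y <-> N (x - y).
Proof.
rewrite -(asboolE (N (x - y))) -submod_predE Quotient.idealrBE.
by split=> [/eqP|/eqP].
Qed.

Lemma lquot_piK (x : lquot) : lquot_pi (repr x) = x.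
Proof. exact: reprK. Qed.

Lemma lquot_piD x y : lquot_pi (x + y) = lquot_pi x + lquot_pi y.
Proof. exact: Quotient.pi_add. Qed.

Definition lquot_scale (k : K) (x : lquot) := lquot_pi (k *: repr x).

Lemma lquot_scaleE k x : lquot_scale k (lquot_pi x) = lquot_pi (k *: x).
Proof.
apply/lquot_piP; rewrite -scalerBr; apply: submodZ.
by apply/lquot_piP; rewrite lquot_piK.
Qed.

Fact lquot_scaleA a b x :
  lquot_scale a (lquot_scale b x) = lquot_scale (a * b) x.
Proof. by rewrite -[x]lquot_piK !lquot_scaleE scalerA. Qed.
Fact lquot_scale1 : left_id 1 lquot_scale.
Proof. by move=> x; rewrite -[x]lquot_piK lquot_scaleE scale1r. Qed.
Fact lquot_scaleDr : right_distributive lquot_scale +%R.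
Proof.
move=> a x y; rewrite -[x]lquot_piK -[y]lquot_piK.
by rewrite -lquot_piD !lquot_scaleE scalerDr lquot_piD.
Qed.
Fact lquot_scaleDl x : {morph lquot_scale^~ x : a b / a + b}.
Proof.
by move=> a b; rewrite -[x]lquot_piK !lquot_scaleE scalerDl lquot_piD.
Qed.
HB.instance Definition _ := GRing.Zmodule_isLmodule.Build K lquot
  lquot_scaleA lquot_scale1 lquot_scaleDr lquot_scaleDl.

Fact lquot_pi_is_linear : linear lquot_pi.
Proof. by move=> k x y; rewrite lquot_piD -lquot_scaleE. Qed.
HB.instance Definition _ := GRing.isLinear.Build K M lquot _ lquot_pi
  lquot_pi_is_linear.

End SubQuot.

Section Span.
Variables (K : pzRingType) (M : lmodType K) (S : M -> Prop).
Definition span_mem (x : M) : Prop :=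
  forall N : submodule M, (forall y, S y -> N y) -> N x.
Fact span0 : span_mem 0. Proof. by move=> N _; apply: submod0. Qed.
Fact spanD x y : span_mem x -> span_mem y -> span_mem (x + y).
Proof. by move=> hx hy N hN; apply: submodD; [apply: hx | apply: hy]. Qed.
Fact spanZ k x : span_mem x -> span_mem (k *: x).
Proof. by move=> hx N hN; apply: submodZ; apply: hx. Qed.
Definition span := Submodule span0 spanD spanZ.
End Span.

Section TwoSidedIdeal.
Variables (K : comNzRingType) (A : lalgType K) (rel : A -> A -> Prop).

(* the two-sided ideal generated by the x - y, for rel x y *)
Definition ideal_mem (x : A) : Prop :=
  forall J : A -> Prop, J 0 -> (forall x y, J x -> J y -> J (x + y)) ->
    (forall a x b, J x -> J (a * x * b)) ->
    (forall x y, rel x y -> J (x - y)) -> J x.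

Fact ideal0 : ideal_mem 0. Proof. by []. Qed.
Fact idealD x y : ideal_mem x -> ideal_mem y -> ideal_mem (x + y).
Proof. by move=> hx hy J h0 hD hM hr; apply: (hD); [apply: hx | apply: hy]. Qed.
Fact idealM a x b : ideal_mem x -> ideal_mem (a * x * b).
Proof. by move=> hx J h0 hD hM hr; apply: (hM); apply: hx. Qed.
Fact idealZ k x : ideal_mem x -> ideal_mem (k *: x).
Proof. by move=> /(idealM k%:A 1); rewrite mulr1 -scalerAl mul1r. Qed.
Definition ideal := Submodule ideal0 idealD idealZ.

Definition presented : Type := lquot ideal.
HB.instance Definition _ := GRing.Lmodule.on presented.
Definition presented_pi : A -> presented := @lquot_pi K A ideal.

Definition presented_mul (x y : presented) : presented :=
  presented_pi (repr (x : Quotient.quot (submod_pred ideal)) *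
                repr (y : Quotient.quot (submod_pred ideal))).

Let piK (x : presented) :
  presented_pi (repr (x : Quotient.quot (submod_pred ideal))) = x.
Proof. exact: lquot_piK. Qed.

Lemma presented_piM x y :
  presented_pi (x * y) = presented_mul (presented_pi x) (presented_pi y).
Proof.
apply/lquot_piP; set x' := repr _; set y' := repr _.
have hx : ideal (x - x') by apply/lquot_piP; rewrite lquot_piK.
have hy : ideal (y - y') by apply/lquot_piP; rewrite lquot_piK.
have -> : x * y - x' * y' = 1 * (x - x') * y + x' * (y - y') * 1.
  by rewrite mul1r mulr1 mulrBl mulrBr addrA subrK.
by apply: idealD; apply: idealM.
Qed.

Fact presented_mulA : associative presented_mul.
Proof.
by move=> x y z; rewrite -[x]piK -[y]piK -[z]piK -!presented_piM mulrA.
Qed.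
Fact presented_mul1 : left_id (presented_pi 1) presented_mul.
Proof. by move=> x; rewrite -[x]piK -presented_piM mul1r. Qed.
Fact presented_1mul : right_id (presented_pi 1) presented_mul.
Proof. by move=> x; rewrite -[x]piK -presented_piM mulr1. Qed.
Let piD x y : presented_pi (x + y) = presented_pi x + presented_pi y.
Proof. exact: lquot_piD. Qed.
Fact presented_mulDl : left_distributive presented_mul +%R.
Proof.
move=> x y z; rewrite -[x]piK -[y]piK -[z]piK.
by rewrite -piD -!presented_piM mulrDl piD.
Qed.
Fact presented_mulDr : right_distributive presented_mul +%R.
Proof.
move=> x y z; rewrite -[x]piK -[y]piK -[z]piK.
by rewrite -piD -!presented_piM mulrDr piD.
Qed.
HB.instance Definition _ := GRing.Zmodule_isPzRing.Build presented
  presented_mulA presented_mul1 presented_1mul presented_mulDl presented_mulDr.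

Lemma presented_pi1 : presented_pi 1 = 1. Proof. by []. Qed.

Lemma presented_pi_mul x y :
  presented_pi (x * y) = presented_pi x * presented_pi y.
Proof. exact: presented_piM. Qed.

Lemma presented_piZ k x : presented_pi (k *: x) = k *: presented_pi x.
Proof. exact: linearZ. Qed.

Lemma presented_pi_surj (x : presented) : exists a, x = presented_pi a.
Proof. by exists (repr (x : Quotient.quot (submod_pred ideal))); rewrite piK. Qed.

Lemma presented_rel x y : rel x y -> presented_pi x = presented_pi y.
Proof.
move=> h; apply/lquot_piP => J _ _ _ hJ; exact: (hJ _ _ h).
Qed.

Fact presented_scaleAl (k : K) (x y : presented) :
  k *: (x * y) = (k *: x) * y.
Proof.
have [a ->] := presented_pi_surj x; have [b ->] := presented_pi_surj y.
by rewrite -presented_pi_mul -!presented_piZ -presented_pi_mul -scalerAl.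
Qed.
End TwoSidedIdeal.

Fact presented_scaleAr (K : comNzRingType) (A : algType K) rel
  (k : K) (x y : @presented K A rel) : k *: (x * y) = x * (k *: y).
Proof.
have [a ->] := presented_pi_surj x; have [b ->] := presented_pi_surj y.
by rewrite -presented_pi_mul -!presented_piZ -presented_pi_mul -scalerAr.
Qed.

(* iota : F -> K is an extension of scalars, V an F-module and X a K-module:
   tensor iota V X is V \otimes_F X, as a K-module through the right factor.
   With iota = idfun this is the usual tensor product, with X = K^o it is the
   extension of scalars V \otimes_F K. *)
Section Tensor.
Variables (F K : fieldType) (iota : {rmorphism F -> K}).
Variables (V : lmodType F) (X : lmodType K).

Inductive tensor_rel : {malg K[(V * X)%type]} -> Prop :=
| tensor_relDl v v' x :
    tensor_rel (<< (v + v', x) >> - << (v, x) >> - << (v', x) >>)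
| tensor_relDr v x x' :
    tensor_rel (<< (v, x + x') >> - << (v, x) >> - << (v, x') >>)
| tensor_relZl c v x :
    tensor_rel (<< (c *: v, x) >> - iota c *: << (v, x) >>)
| tensor_relZr k v x :
    tensor_rel (<< (v, k *: x) >> - k *: << (v, x) >>).

Definition tensor : Type := lquot (span tensor_rel).
HB.instance Definition _ := GRing.Lmodule.on tensor.

Definition pure (v : V) (x : X) : tensor := lquot_pi _ << (v, x) >>.
End Tensor.

(* X as an F-module, through iota *)
Section Restriction.
Variables (F K : fieldType) (iota : {rmorphism F -> K}) (X : lmodType K).
Definition restrict (f : {rmorphism F -> K}) : Type := X.
HB.instance Definition _ := GRing.Zmodule.on (restrict iota).
Definition restrict_scale (c : F) (x : restrict iota) : restrict iota :=
  iota c *: (x : X).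
Fact restrict_scaleA a b x :
  restrict_scale a (restrict_scale b x) = restrict_scale (a * b) x.
Proof. by rewrite /restrict_scale scalerA rmorphM. Qed.
Fact restrict_scale1 : left_id 1 restrict_scale.
Proof. by move=> x; rewrite /restrict_scale rmorph1 scale1r. Qed.
Fact restrict_scaleDr : right_distributive restrict_scale +%R.
Proof. by move=> a x y; rewrite /restrict_scale scalerDr. Qed.
Fact restrict_scaleDl x : {morph restrict_scale^~ x : a b / a + b}.
Proof. by move=> a b; rewrite /restrict_scale rmorphD scalerDl. Qed.
HB.instance Definition _ := GRing.Zmodule_isLmodule.Build F (restrict iota)
  restrict_scaleA restrict_scale1 restrict_scaleDr restrict_scaleDl.
End Restriction.

Record cartan_datum := CartanDatum {
  rk : nat;
  cmat : 'M[int]_rk;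
  symmz : 'I_rk -> nat;
  cmat_diag : forall i, cmat i i = 2;
  cmat_off : forall i j, i != j -> cmat i j <= 0;
  cmat_zero : forall i j, cmat i j = 0 <-> cmat j i = 0;
  symmz_gt0 : forall i, (0 < symmz i)%N;
  cmat_sym : forall i j, (symmz i)%:Z * cmat i j = (symmz j)%:Z * cmat j i
}.

Record realization (X : cartan_datum) := Realization {
  hspace : vectType rat;
  alpha : 'I_(rk X) -> 'Hom(hspace, rat^o);
  alphav : 'I_(rk X) -> hspace;
  hspace_dim : \dim {:hspace} =
    (2 * rk X - \rank (map_mx intr (cmat X) : 'M[rat]_(rk X)))%N;
  alpha_free : free [seq alpha i | i : 'I_(rk X)];
  alphav_free : free [seq alphav i | i : 'I_(rk X)];
  alphaE : forall i j, alpha j (alphav i) = (cmat X i j)%:~R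
}.

(* qpow is the fixed choice of rational powers of q *)
Record qparam (F : fieldType) := QParam {
  qq : F;
  qpow : rat -> F;
  qq_neq0 : qq != 0;
  qq_nonroot : forall m, (0 < m)%N -> qq ^+ m != 1;
  qpow1 : qpow 1 = qq;
  qpowD : forall s t, qpow (s + t) = qpow s * qpow t
}.

Record qaff_datum (F : fieldType) := QAffDatum {
  qcartan :> cartan_datum;
  qreal : realization qcartan;
  qpar : qparam F
}.

Definition qint (F : fieldType) (q : F) (l : int) : F :=
  (q ^ l - q ^ (- l)) / (q - q^-1).
Definition qfact (F : fieldType) (q : F) (n : nat) : F :=
  \prod_(1 <= k < n.+1) qint q k%:Z.
Definition qbin (F : fieldType) (q : F) (s k : nat) : F :=
  qfact q s / (qfact q k * qfact q (s - k)).

(* formal power series, as sequences of coefficients *)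
Section FormalSeries.
Variables (F : fieldType) (A : lalgType F).
Definition fps_one (n : nat) : A := (n == 0)%:R.
Definition fps_mul (a b : nat -> A) (n : nat) : A :=
  \sum_(k < n.+1) a k * b (n - k)%N.
(* exp(a), for a without constant term: a ^ k does not contribute to the
   coefficient of z ^ n if n < k *)
Definition fps_exp (a : nat -> A) (n : nat) : A :=
  \sum_(k < n.+1) (k`!%:R)^-1 *: iter k (fps_mul a) fps_one n.
End FormalSeries.

(* A sign b : bool stands for + if b is true and for - otherwise. *)
Definition sgb (b : bool) : int := if b then 1 else -1.

Fact malg_scaleAr (F : fieldType) (T : monomType) (k : F) (x y : {malg F[T]}) :
  k *: (x * y) = x * (k *: y).
Proof.
apply/malgP => m; rewrite mcoeffZ mcoeffMl.
rewrite (mcoeffMlw m (fsubset_refl _) (msuppZ_le k y)) mulr_sumr.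
apply: eq_bigr => m1 _; rewrite mulr_sumr; apply: eq_bigr => m2 _.
by rewrite mcoeffZ mulrnAr mulrCA.
Qed.

Section QuantumAffinization.
Variables (F : fieldType) (d : qaff_datum F).
Local Notation I := 'I_(rk d).
Local Notation h := (hspace (qreal d)).
Local Notation q := (qq (qpar d)).

Definition qi (i : I) : F := q ^+ symmz i.
Definition bmat (i j : I) : int := (symmz i)%:Z * cmat d i j.

(* x^{+-}_{i,r}, k_h, h_{i,m} *)
Definition gen : Type :=
  ((bool * I * int) + h + (I * {m : int | m != 0}))%type.
HB.instance Definition _ := Choice.on gen.

Definition freealg : Type := {malg F[{fmonom gen}]}.
HB.instance Definition _ := GRing.Lalgebra.on freealg.

Fact freealg_scaleAr (k : F) (x y : freealg) : k *: (x * y) = x * (k *: y).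
Proof. exact: malg_scaleAr. Qed.
HB.instance Definition _ :=
  GRing.Lalgebra_isAlgebra.Build F freealg freealg_scaleAr.

Definition fgen (g : gen) : freealg := << fmu g >>.
Definition fX (b : bool) (i : I) (r : int) : freealg :=
  fgen (inl (inl (b, i, r))).
Definition fK (x : h) : freealg := fgen (inl (inr x)).
(* h_{i,m}, with the junk value 0 at m = 0 *)
Definition fH (i : I) (m : int) : freealg :=
  if insub m is Some m' then fgen (inr (i, m')) else 0.

(* phi^+_{i,m} (b = true) or phi^-_{i,-m} (b = false) *)
Definition fphi (b : bool) (i : I) (m : nat) : freealg :=
  fK (alphav _ i *~ (sgb b * (symmz i)%:Z)) *
  fps_exp (fun j => ((sgb b)%:~R * (q - q^-1)) *: fH i (sgb b * j%:Z)) m.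

(* phi^{+-}_{i,m} *)
Definition fphiz (b : bool) (i : I) (m : int) : freealg :=
  if 0 <= sgb b * m then fphi b i `|m|%N else 0.

(* coefficient of w_0^(m 0) ... w_(s-1)^(m (s-1)) z^r *)
Definition fserre (b : bool) (i j : I) (s : nat) (m : 'I_s -> int) (r : int) :
    freealg :=
  \sum_(p : 'S_s) \sum_(k < s.+1)
    ((-1) ^+ k * qbin (qi i) s k) *:
      ((\prod_(l < s | (l < k)%N) fX b i (m (p l))) * fX b j r *
       (\prod_(l < s | (k <= l)%N) fX b i (m (p l)))).

Inductive qrel : freealg -> freealg -> Prop :=
| qrel_kD x y : qrel (fK x * fK y) (fK (x + y))
| qrel_k0 : qrel (fK 0) 1
| qrel_kk x y : qrel (fK x * fK y) (fK y * fK x)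
| qrel_kh x i m : m != 0 -> qrel (fK x * fH i m) (fH i m * fK x)
| qrel_hh i m j p : m != 0 -> p != 0 ->
    qrel (fH i m * fH j p) (fH j p * fH i m)
| qrel_kx b x j r :
    qrel (fK x * fX b j r * fK (- x))
         (qpow (qpar d) ((sgb b)%:~R * alpha _ j x) *: fX b j r)
| qrel_hx b i m j r : m != 0 ->
    qrel (fH i m * fX b j r - fX b j r * fH i m)
         (((sgb b)%:~R / m%:~R * qint q (m * bmat i j)) *: fX b j (m + r))
| qrel_xx i j r s :
    qrel (fX true i r * fX false j s - fX false j s * fX true i r)
         (if i == j then (qi i - (qi i)^-1)^-1 *:
            (fphiz true i (r + s) - fphiz false i (r + s)) else 0)
(* coefficient of z^r w^s in
   (w - q^{+-B_ij} z) x_i(z) x_j(w) = (q^{+-B_ij} w - z) x_j(w) x_i(z) *)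
| qrel_drinfeld b i j r s :
    qrel (fX b i r * fX b j (s - 1) -
            q ^ (sgb b * bmat i j) *: (fX b i (r - 1) * fX b j s))
         (q ^ (sgb b * bmat i j) *: (fX b j (s - 1) * fX b i r) -
            fX b j s * fX b i (r - 1))
| qrel_serre b i j (m : 'I_(`|1 - cmat d i j|%N) -> int) r :
    (forall i' j', i' != j' -> cmat d i' j' * cmat d j' i' <= 3) ->
    i != j -> qrel (fserre b i j m r) 0.

Definition Uq : Type := presented qrel.
HB.instance Definition _ := GRing.PzRing.on Uq.
HB.instance Definition _ := GRing.Lmodule.on Uq.

(* The character k_h |-> 1, x^{+-}_{i,r} |-> 0, h_{i,m} |-> 0 shows that Uq is
   not the zero ring. *)
Definition is_kgen (g : gen) : bool := if g is inl (inr _) then true else false.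
Definition counit_mon (m : {fmonom gen}) : F := (all is_kgen m)%:R.
Fact counit_mon_mmorphism : mmorphism counit_mon.
Proof.
split=> [m1 m2|]; last by rewrite /counit_mon fm1.
by rewrite /counit_mon fmM all_cat -mulnb natrM.
Qed.
HB.instance Definition _ := monalg.isMultiplicative.Build
  {fmonom gen} F counit_mon counit_mon_mmorphism.
Definition counit : freealg -> F := mmap idfun counit_mon.
HB.instance Definition _ := GRing.RMorphism.on counit.
Let counitM x y : counit (x * y) = counit x * counit y.
Proof. exact: rmorphM. Qed.
Let counitB x y : counit (x - y) = counit x - counit y.
Proof. exact: rmorphB. Qed.
Let counitD x y : counit (x + y) = counit x + counit y.
Proof. exact: rmorphD. Qed.
Let counitZ c x : counit (c *: x) = c * counit x.
Proof. exact: mmapZ. Qed.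
Let counit_sum (J : finType) (f : J -> freealg) :
  (forall l, counit (f l) = 0) -> counit (\sum_l f l) = 0.
Proof. by move=> f0; rewrite rmorph_sum big1. Qed.
Let counit_gen g : counit (fgen g) = (is_kgen g)%:R.
Proof. by rewrite /counit mmapU mul1r /counit_mon fmuE /= andbT. Qed.
Let counitX b i r : counit (fX b i r) = 0. Proof. exact: counit_gen. Qed.
Let counitK x : counit (fK x) = 1. Proof. exact: counit_gen. Qed.
Let counitH i m : counit (fH i m) = 0.
Proof. by rewrite /fH; case: insubP => *; rewrite ?counit_gen ?rmorph0. Qed.
Let counitMl x y : counit x = 0 -> counit (x * y) = 0.
Proof. by rewrite counitM => ->; rewrite mul0r. Qed.
Let counitMr x y : counit y = 0 -> counit (x * y) = 0.
Proof. by rewrite counitM => ->; rewrite mulr0. Qed.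
Let counitB0 x y : counit x = 0 -> counit y = 0 -> counit (x - y) = 0.
Proof. by rewrite counitB => -> ->; rewrite subrr. Qed.
Let counitZ0 c x : counit x = 0 -> counit (c *: x) = 0.
Proof. by rewrite counitZ => ->; rewrite mulr0. Qed.
Let counitMC x y : counit (x * y) = counit (y * x).
Proof.
exact: etrans (counitM x y) (etrans (mulrC _ _) (esym (counitM y x))).
Qed.
Let counit_phi b i m : counit (fphi b i m) = (m == 0%N)%:R.
Proof.
rewrite counitM counitK mul1r /fps_exp big_ord_recl counitD counitZ.
rewrite fact0 invr1 mul1r [X in _ + X]counit_sum ?addr0 => [|k].
  exact: rmorph_nat.
apply: counitZ0; apply: counit_sum => l.
by apply: counitMl; apply: counitZ0; apply: counitH.
Qed.
Let counit_phiz b i m : counit (fphiz b i m) = (m == 0)%:R.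
Proof.
rewrite /fphiz; case: ifP => [_|].
  by rewrite counit_phi absz_eq0.
by case: eqP => [->|_ _]; rewrite ?mulr0 ?lexx // rmorph0.
Qed.
Let counit_rel x y : qrel x y -> counit x = counit y.
Proof.
case=> {x y}.
- by move=> x y; rewrite counitM !counitK mulr1.
- by rewrite counitK rmorph1.
- by move=> x y; apply: counitMC.
- by move=> x i m _; apply: counitMC.
- by move=> i m j p _ _; apply: counitMC.
- move=> b x j r; rewrite [RHS]counitZ0 ?counitX //.
  by apply/counitMl/counitMr/counitX.
- move=> b i m j r _; rewrite [RHS]counitZ0 ?counitX //.
  by apply: counitB0; [apply: counitMr | apply: counitMl]; apply: counitX.
- move=> i j r s; rewrite [LHS]counitB0; [| exact/counitMl/counitX ..].
  case: eqP => _; last by rewrite rmorph0.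
  apply: esym; apply: counitZ0; apply: etrans (counitB _ _) _.
  apply/eqP; rewrite subr_eq0; apply/eqP.
  exact: etrans (counit_phiz _ _ _) (esym (counit_phiz _ _ _)).
- move=> b i j r s; apply: etrans (counitB0 _ _) (esym (counitB0 _ _)).
  + exact/counitMl/counitX.
  + exact/counitZ0/counitMl/counitX.
  + exact/counitZ0/counitMl/counitX.
  + exact/counitMl/counitX.
- move=> b i j m r _ _; rewrite rmorph0; apply: counit_sum => p.
  apply: counit_sum => k; apply: counitZ0.
  exact/counitMl/counitMr/counitX.
Qed.
Fact Uq_neq0 : (1 : Uq) != 0.
Proof.
apply/eqP => eq10; suff: counit 1 = 0 by move/eqP; rewrite rmorph1 oner_eq0.
have h1 : ideal qrel (1 - 0).
  by apply/lquot_piP; rewrite [RHS]linear0; exact: eq10.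
rewrite subr0 in h1.
apply: (h1 (fun x => counit x = 0)).
- exact: rmorph0.
- by move=> x y hx hy; rewrite rmorphD /= hx hy addr0.
- by move=> a x b hx; apply/counitMl/counitMr.
- by move=> x y /counit_rel hxy; rewrite counitB hxy subrr.
Qed.
HB.instance Definition _ := GRing.PzSemiRing_isNonZero.Build Uq Uq_neq0.
HB.instance Definition _ :=
  GRing.Lmodule_isLalgebra.Build F Uq (@presented_scaleAl _ _ qrel).
HB.instance Definition _ :=
  GRing.Lalgebra_isAlgebra.Build F Uq (@presented_scaleAr _ _ qrel).

Definition Uq_pi (a : freealg) : Uq := presented_pi qrel a.

Definition Ux b i r : Uq := Uq_pi (fX b i r).
Definition Uk x : Uq := Uq_pi (fK x).
Definition Uh i m : Uq := Uq_pi (fH i m).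
Definition Uphi b i m : Uq := Uq_pi (fphi b i m).
End QuantumAffinization.
Arguments qi {F} d i.
Arguments Ux {F} d b i r.
Arguments Uk {F} d x.
Arguments Uh {F} d i m.
Arguments Uphi {F} d b i m.

Section Modules.
Variables (F : fieldType) (d : qaff_datum F).
Local Notation I := 'I_(rk d).
Local Notation h := (hspace (qreal d)).
Local Notation q := (qq (qpar d)).
Local Notation U := (Uq d).

(* For an extension iota : F -> K, these are the modules over Uq \otimes_F K:
   K-modules with a K-linear action of Uq. *)
Section OverExtension.
Variables (K : fieldType) (iota : {rmorphism F -> K}).

Record is_Uaction (M : lmodType K) (act : U -> M -> M) : Prop := IsUaction {
  Uact_linear : forall g k x y, act g (k *: x + y) = k *: act g x + act g y;
  UactD : forall g g' x, act (g + g') x = act g x + act g' x;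
  UactZ : forall c g x, act (c *: g) x = iota c *: act g x;
  Uact1 : forall x, act 1 x = x;
  UactM : forall g g' x, act (g * g') x = act g (act g' x)
}.

Record Umod := UMod {
  Ucarrier :> lmodType K;
  Uact : U -> Ucarrier -> Ucarrier;
  Uact_axiom : is_Uaction Uact
}.
End OverExtension.

Definition Fmod := Umod (idfun : {rmorphism F -> F}).

Section Restrict.
Variables (K : fieldType) (iota : {rmorphism F -> K}) (M : Umod iota).
Definition Urestrict_act (g : U) (x : restrict M iota) : restrict M iota :=
  Uact g (x : M).
Fact Urestrict_axiom :
  @is_Uaction F (idfun : {rmorphism F -> F}) (restrict M iota) Urestrict_act.
Proof.
case: (Uact_axiom M) => hl hD hZ h1 hM; split=> //.
by move=> g k x y; apply: hl.
Qed.
Definition Urestrict : Fmod := UMod Urestrict_axiom.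
End Restrict.

Section SubQuotient.
Variables (M : Fmod) (N : submodule M).
Hypothesis stableN : forall (g : U) x, N x -> N (Uact g x).

Fact Usub_mem (g : U) (x : subspace N) :
  Uact g (val x) \in submod_pred N.
Proof. by apply/asboolP/stableN/asboolP; apply: valP x. Qed.
Definition Usub_act (g : U) (x : subspace N) : subspace N :=
  Subspace (Usub_mem g x).
Fact Usub_axiom : @is_Uaction F (idfun : {rmorphism F -> F}) _ Usub_act.
Proof.
case: (Uact_axiom M) => hl hD hZ h1 hM.
split=> *; apply: val_inj => /=; rewrite ?linearP /=.
- exact: hl.
- exact: hD.
- exact: hZ.
- exact: h1.
- exact: hM.
Qed.
Definition Usub : Fmod := UMod Usub_axiom.

Definition Uquot_act (g : U) (x : lquot N) : lquot N :=
  lquot_pi N (Uact g (repr (x : Quotient.quot (submod_pred N)))).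
Fact Uquot_actE g x : Uquot_act g (lquot_pi N x) = lquot_pi N (Uact g x).
Proof.
apply/lquot_piP; case: (Uact_axiom M) => hl _ _ _ _.
have hB (a b : M) : Uact g (a - b) = Uact g a - Uact g b.
  by rewrite addrC -scaleN1r hl scaleN1r addrC.
by rewrite -hB; apply: stableN; apply/lquot_piP; rewrite lquot_piK.
Qed.
Fact Uquot_axiom : @is_Uaction F (idfun : {rmorphism F -> F}) _ Uquot_act.
Proof.
case: (Uact_axiom M) => hl hD hZ h1 hM.
split=> [g k x y|g g' x|c g x|x|g g' x].
- rewrite -[x]lquot_piK -[y]lquot_piK -linearZ -lquot_piD !Uquot_actE.
  by rewrite hl lquot_piD linearZ.
- by rewrite -[x]lquot_piK !Uquot_actE hD lquot_piD.
- by rewrite -[x]lquot_piK !Uquot_actE hZ linearZ.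
- by rewrite -[x]lquot_piK Uquot_actE h1.
- by rewrite -[x]lquot_piK !Uquot_actE hM.
Qed.
Definition Uquot : Fmod := UMod Uquot_axiom.
End SubQuotient.

Definition weight := 'Hom(h, rat^o).

Definition wspace (V : Fmod) (w : weight) (x : V) : Prop :=
  forall t : h, Uact (Uk d t) x = qpow (qpar d) (w t) *: x.

(* w \in lam - Q^+ *)
Definition in_cone (lam w : weight) : Prop :=
  exists c : I -> nat, w = lam - \sum_i (alpha (qreal d) i : weight) *+ c i.

Definition is_integral (lam : weight) : Prop :=
  forall i, lam (alphav (qreal d) i) \is a Num.int.

Record in_Mod (V : Fmod) : Prop := InMod {
  Mod_sum : forall x : V, exists (s : seq weight) (f : weight -> V),
    (forall w, wspace w (f w)) /\ x = \sum_(w <- s) f w;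
  Mod_direct : forall (s : seq weight) (f : weight -> V), uniq s ->
    (forall w, wspace w (f w)) -> \sum_(w <- s) f w = 0 ->
    forall w, w \in s -> f w = 0;
  Mod_fin_dim : forall w, exists (n : nat) (b : 'I_n -> V),
    (forall l, wspace w (b l)) /\
    (forall x, wspace w x -> exists a : 'I_n -> F, x = \sum_l a l *: b l);
  Mod_cone : exists lams : seq weight, forall w,
    (exists x : V, wspace w x /\ x != 0) ->
    exists2 lam, lam \in lams & in_cone lam w;
  Mod_integrable : forall (w : weight) (i : I), exists R : nat,
    forall r, (R <= r)%N -> forall x : V,
    (wspace (w + (alpha (qreal d) i : weight) *+ r) x -> x = 0) /\
    (wspace (w - (alpha (qreal d) i : weight) *+ r) x -> x = 0)
}.

(* l-weights; lpsi b i m is Psi^+_{i,m} if b = true, Psi^-_{i,-m} otherwise *)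
Record lweight := LWeight {
  lwt : weight;
  lpsi : bool -> I -> nat -> F;
  lwt_integral : is_integral lwt;
  lpsi0 : forall b i,
    lpsi b i 0 =
    qpow (qpar d) ((sgb b)%:~R * (symmz i)%:R * lwt (alphav (qreal d) i))
}.

(* An l-highest weight vector is nonzero, so that L is determined by V. *)
Record is_lhighest (V : Fmod) (L : lweight) (v : V) : Prop := IsLHighest {
  lh_neq0 : v != 0;
  lh_weight : wspace (lwt L) v;
  lh_gen : forall x : V, exists g : U, x = Uact g v;
  lh_x : forall i r, Uact (Ux d true i r) v = 0;
  lh_phi : forall b i m, Uact (Uphi d b i m) v = lpsi L b i m *: v
}.

(* With the denominator P(z q_i) cleared: the coefficients of z^m in
   P(z q_i) Psi^+(z) = q_i^(deg P) P(z q_i^-1), m >= 0, and of z^j in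
   P(z q_i) Psi^-(z) = q_i^(deg P) P(z q_i^-1), j an integer. *)
Definition is_drinfeld (L : lweight) (P : I -> {poly F}) : Prop :=
  forall i, [/\ (P i).[0] = 1,
    forall m : nat,
      \sum_(a < m.+1) (P i)`_a * qi d i ^+ a * lpsi L true i (m - a) =
      qi d i ^+ (size (P i)).-1 * ((P i)`_m * qi d i ^- m) &
    forall j : int,
      \sum_(a < size (P i) | j <= a%:Z)
        (P i)`_a * qi d i ^+ a * lpsi L false i `|a%:Z - j|%N =
      qi d i ^+ (size (P i)).-1 *
        (if 0 <= j then (P i)`_(`|j|%N) * qi d i ^- `|j|%N else 0)].

Definition Fu : fieldType := {fraction {poly F}}.
Definition const_u : {rmorphism F -> Fu} := (@tofrac {poly F}) \o (@polyC F).
Definition uvar : Fu := tofrac 'X.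
Local Notation u := uvar.

(* V_1 \otimes (V_2 \otimes ... (V_r \otimes F(u))) *)
Fixpoint fspace (r : nat) : ('I_r.+1 -> Fmod) -> lmodType Fu :=
  match r with
  | 0 => fun V => tensor const_u (V ord0) Fu^o
  | r'.+1 => fun V => tensor const_u (V ord0) (fspace (fun j => V (lift ord0 j)))
  end.

Fixpoint ptensor (r : nat) : forall V : 'I_r.+1 -> Fmod,
    (forall j, V j) -> fspace V :=
  match r with
  | 0 => fun V x => pure const_u (x ord0) (1 : Fu^o)
  | r'.+1 => fun V x =>
      pure const_u (x ord0) (ptensor (fun j => x (lift ord0 j)))
  end.

(* c \in u^N F[[u]], for c in F(u) *)
Definition u_order (N : nat) (c : Fu) : Prop :=
  exists f g : {poly F}, g.[0] != 0 /\ c = u ^+ N * (tofrac f / tofrac g).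

(* w \in u^N (V_1 \otimes ... \otimes V_r)[[u]] *)
Definition fspace_order (r : nat) (V : 'I_r.+1 -> Fmod) (N : nat)
    (w : fspace V) : Prop :=
  exists (n : nat) (c : 'I_n -> Fu) (x : 'I_n -> forall j, V j),
    (forall l, u_order N (c l)) /\ w = \sum_l c l *: ptensor (x l).

(* The series \sum_(s >= 0) y s converges u-adically in
   (V_1 \otimes ... \otimes V_r)((u)), and its sum is the expansion of w. *)
Definition u_sum (r : nat) (V : 'I_r.+1 -> Fmod) (y : nat -> fspace V)
    (w : fspace V) : Prop :=
  forall N : nat, exists n0 : nat, forall n, (n0 <= n)%N ->
    fspace_order N (w - \sum_(s < n) y s).

(* g.(v \otimes w') = Delta_u(g)(v \otimes w') for g one of x^{+-}_{i,m},
   phi^{+-}_{i,+-m}, k_t. As Delta_u is a morphism of algebras and these elements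
   generate Uq (the phi determine the h_{i,m}), this fixes the action of Uq. *)
Record is_coproduct_action (r : nat) (V : 'I_r.+2 -> Fmod)
  (act' : U -> fspace (fun j => V (lift ord0 j)) ->
          fspace (fun j => V (lift ord0 j)))
  (act : U -> fspace V -> fspace V) : Prop := IsCoproductAction {
  cop_xp : forall i m (v : V ord0) w',
    u_sum (fun s => u ^ (m + s%:Z) *:
             (pure const_u (Uact (Uphi d false i s) v)
                (act' (Ux d true i (m + s%:Z)) w') : fspace V))
      (act (Ux d true i m) (pure const_u v w')
         - pure const_u (Uact (Ux d true i m) v) w');
  cop_xm : forall i m (v : V ord0) w',
    u_sum (fun s => u ^+ s *:
             (pure const_u (Uact (Ux d false i (m - s%:Z)) v)
                (act' (Uphi d true i s) w') : fspace V))
      (act (Ux d false i m) (pure const_u v w')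
         - u ^ m *: (pure const_u v (act' (Ux d false i m) w') : fspace V));
  cop_phi : forall b i m (v : V ord0) w',
    act (Uphi d b i m) (pure const_u v w') =
    \sum_(s < m.+1) u ^ (sgb b * s%:Z) *:
      (pure const_u (Uact (Uphi d b i (m - s)) v)
         (act' (Uphi d b i s) w') : fspace V);
  cop_k : forall t (v : V ord0) w',
    act (Uk d t) (pure const_u v w') =
    (pure const_u (Uact (Uk d t) v) (act' (Uk d t) w') : fspace V)
}.

Fixpoint is_fusion (r : nat) : forall V : 'I_r.+1 -> Fmod,
    (U -> fspace V -> fspace V) -> Prop :=
  match r with
  | 0 => fun V act => is_Uaction const_u act /\
      forall g (v : V ord0) (c : Fu^o),
        act g (pure const_u v c) = pure const_u (Uact g v) c
  | r'.+1 => fun V act => is_Uaction const_u act /\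
      exists2 act', is_fusion act' & is_coproduct_action act' act
  end.

Lemma is_fusion_Uaction (r : nat) (V : 'I_r.+1 -> Fmod)
  (act : U -> fspace V -> fspace V) : is_fusion act -> is_Uaction const_u act.
Proof. by case: r V act => [|r] V act []. Qed.

(* The fusion module i(V_1) \otimes_f ... \otimes_f i(V_r). It is determined by
   the V_j, as u_sum has at most one value; its existence is the rationality in
   u of the series given by Delta_u. *)
Record fusion_module (r : nat) (V : 'I_r.+1 -> Fmod) := FusionModule {
  fusion_act : U -> fspace V -> fspace V;
  fusion_axiom : is_fusion fusion_act
}.

Definition fusion_Umod (r : nat) (V : 'I_r.+1 -> Fmod) (W : fusion_module V) :
  Umod const_u := UMod (is_fusion_Uaction (fusion_axiom W)).
Coercion fusion_Umod : fusion_module >-> Umod.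

(* The subring A = {f/g | f, g \in F[u, u^-1], g(1) != 0} of F(u) *)
Definition in_A (x : Fu) : Prop :=
  exists (f g : {poly F}) (a b : nat), g.[1] != 0 /\
    x = (tofrac f / u ^+ a) / (tofrac g / u ^+ b).

Section Specialization.
Variables (W : Umod const_u) (v : W).

(* (Uq \otimes A).v *)
Definition lattice_mem (w : restrict W const_u) : Prop :=
  exists s : seq (Fu * U), (forall p, p \in s -> in_A p.1) /\
    (w : W) = \sum_(p <- s) p.1 *: Uact p.2 v.

Fact lattice0 : lattice_mem 0.
Proof. by exists [::]; rewrite big_nil. Qed.
Fact latticeD x y : lattice_mem x -> lattice_mem y -> lattice_mem (x + y).
Proof.
move=> [s [hs ->]] [t [ht ->]]; exists (s ++ t); rewrite big_cat; split=> //.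
by move=> p; rewrite mem_cat => /orP[/hs|/ht].
Qed.
Fact in_AZ c x : in_A x -> in_A (const_u c * x).
Proof.
move=> [f [g [a [b [hg ->]]]]]; exists (c%:P * f), g, a, b; split=> //.
by rewrite rmorphM /= !mulrA.
Qed.
Fact latticeZ c x : lattice_mem x -> lattice_mem (c *: x).
Proof.
move=> [s [hs ->]]; exists [seq (const_u c * p.1, p.2) | p <- s]; split.
  by move=> p /mapP[p' /hs hp' ->]; apply: in_AZ.
rewrite big_map; apply: etrans (scaler_sumr _ _ _ _) _.
by apply: eq_bigr => p _; rewrite scalerA.
Qed.
Definition lattice : submodule (Urestrict W) :=
  @Submodule F (Urestrict W) lattice_mem lattice0 latticeD latticeZ.

Fact Uact0 (g : U) : Uact g (0 : W) = 0.
Proof.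
have := Uact_linear (Uact_axiom W) g (-1) 0 0.
by rewrite scaler0 addr0 scaleN1r addNr.
Qed.
Fact UactDr (g : U) (x y : W) : Uact g (x + y) = Uact g x + Uact g y.
Proof. by rewrite -[x]scale1r (Uact_linear (Uact_axiom W)) !scale1r. Qed.
Fact UactZr (g : U) c (x : W) : Uact g (c *: x) = c *: Uact g x.
Proof.
by rewrite -[c *: x]addr0 (Uact_linear (Uact_axiom W)) Uact0 addr0.
Qed.

Fact Uact_comb (g : U) (s : seq (Fu * U)) :
  Uact g (\sum_(p <- s) p.1 *: Uact p.2 v) =
  \sum_(p <- s) p.1 *: Uact (g * p.2) v.
Proof.
elim: s => [|p s ih]; first by rewrite !big_nil Uact0.
rewrite big_cons UactDr UactZr ih [RHS]big_cons; congr (_ *: _ + _).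
exact: esym (UactM (Uact_axiom W) _ _ _).
Qed.

Fact lattice_stable (g : U) (x : Urestrict W) :
  lattice x -> lattice (Uact g x).
Proof.
move=> [s [hs hx]]; exists [seq (p.1, g * p.2) | p <- s]; split.
  by move=> p /mapP[p' /hs hp' ->].
by rewrite big_map -Uact_comb -hx.
Qed.
Definition lattice_mod : Fmod := Usub lattice_stable.

Fact lattice_v : (v : Urestrict W) \in submod_pred lattice.
Proof.
apply/asboolP; exists [:: (1, 1)]; split.
  move=> p; rewrite inE => /eqP -> /=; exists 1, 1, 0%N, 0%N.
  by rewrite hornerC oner_neq0 rmorph1 !expr0 !divr1.
by rewrite big_seq1 scale1r (Uact1 (Uact_axiom W)).
Qed.
Definition lattice_vec : lattice_mod := Subspace lattice_v.

(* (u - 1) \tilde W(v) *)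
Definition um1_mem (x : lattice_mod) : Prop :=
  exists y : lattice_mod,
    (subspace_val x : W) = (u - 1) *: (subspace_val y : W).
Fact um1_0 : um1_mem 0.
Proof. by exists 0; rewrite scaler0. Qed.
Fact um1_D x y : um1_mem x -> um1_mem y -> um1_mem (x + y).
Proof.
by move=> [x' hx] [y' hy]; exists (x' + y'); rewrite /= scalerDr -hx -hy.
Qed.
Fact um1_Z c x : um1_mem x -> um1_mem (c *: x).
Proof.
move=> [x' hx]; exists (c *: x'); apply: etrans (congr1 ( *:%R (const_u c)) hx) _.
by rewrite scalerA mulrC -scalerA.
Qed.
Definition um1 : submodule lattice_mod := Submodule um1_0 um1_D um1_Z.
Fact um1_stable (g : U) (x : lattice_mod) : um1 x -> um1 (Uact g x).
Proof.
move=> [x' hx]; exists (Uact g x').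
have := congr1 (fun z : W => Uact g z) hx; rewrite UactZr; exact.
Qed.

(* \tilde W(v) / (u - 1) \tilde W(v), and the class of v in it *)
Definition special : Fmod := Uquot um1_stable.
Definition special_vec : special := lquot_pi um1 lattice_vec.
End Specialization.
End Modules.

(* Main.v *)
Require Import Defs.
From mathcomp Require Import all_boot all_order all_algebra.
From mathcomp Require Import reals complex.
From mathcomp Require Import boolp finmap monalg fraction generic_quotient zify.

Set Implicit Arguments.
Unset Strict Implicit.
Unset Printing Implicit Defensive.

Import Order.TTheory GRing.Theory Num.Theory.
Local Open Scope ring_scope.

(* the span of a set of vectors, as opposed to that of a sequence *)
Local Notation lspan := Defs.span.

(**
Everything is read off from weights.

The torus acts on a pure tensor factor by factor, and each V_j is spanned by
products of elements x^-_{i,r} applied to v_j, so its weights lie in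
lambda_j - Q^+. Hence the fusion module W is spanned over F(u) by tensor
products of weight vectors, its weights lie in lambda - Q^+ with
lambda = \sum_j lambda_j, its weight spaces are finite dimensional over F(u),
and it inherits the integrability condition: for bounded coefficients on the
other simple roots, the coefficient of alpha_i is bounded as well
([graded_tensor]). In particular x^+_{i,r} v has the weight lambda + alpha_i
and must vanish. The coproduct of phi^{+-}_{i,m} is a finite sum, so v is an
eigenvector of phi^{+-}_{i,m} for a Laurent polynomial in u whose value at
u = 1 is a convolution of the l-weights of the v_j ([fusion_top]).

Let A be the ring of fractions regular at u = 1. By the commutation relations
the lattice A U.v is the A-span of the words x^- ... x^- v
([word_span_gen]), which lie in weights lambda - beta; only the empty word has
weight lambda. Three consequences:
- W carries a linear form that takes the value 1 at v and is homogeneous of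
  weight lambda (a tensor product of such forms on the V_j). It maps the
  lattice into A, so v is not in (u - 1) times the lattice, and the class of v
  is nonzero ([special_vec_neq0]).
- Each weight space of the specialization is the image of the weight space of
  the lattice, whence the bounds on its weights ([wsp_lattice_wspace]).
- If a weight space of W has dimension n over F(u), then n + 1 vectors of the
  lattice in it satisfy a linear relation over F(u); rescaled by a power of
  u - 1 so as to be regular and nonzero at u = 1, it specializes to a
  nontrivial relation over F ([special_dependent]). So the weight spaces stay
  finite dimensional, even if the lattice were not finitely generated.

Finally c in A acts on the specialization by c(1), so the l-weight of the class
of v is the convolution of the given l-weights. The defining identities of
Drinfeld polynomials are identities A(z) f(z) = B(z) between polynomials and a
power series, in z for the sign + and in 1/z (after reversing the polynomials)
for the sign -, and such identities can be multiplied ([series_eq_mul]).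
*)

(** * Spans and linear maps *)

Section SpanTheory.
Variables (K : pzRingType) (M : lmodType K).
Implicit Types (S : M -> Prop) (N : submodule M).

Lemma mem_span S x : S x -> lspan S x.
Proof. by move=> Sx N; apply. Qed.

Lemma span_min S N x : (forall y, S y -> N y) -> lspan S x -> N x.
Proof. by move=> SN; apply. Qed.

Lemma span_mono S S' x :
  (forall y, S y -> lspan S' y) -> lspan S x -> lspan S' x.
Proof. exact: span_min. Qed.

Lemma span_eq0 S x : (forall y, S y -> y = 0) -> lspan S x -> x = 0.
Proof.
have Z0 c (y : M) : y = 0 -> c *: y = 0 by move->; rewrite scaler0.
have D0 (y z : M) : y = 0 -> z = 0 -> y + z = 0 by move=> -> ->; rewrite addr0.
exact: (@span_min _ (Submodule (submod_mem := fun y => y = 0) erefl D0 Z0)).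
Qed.

Lemma submod_sum N (J : Type) (s : seq J) (p : pred J) (f : J -> M) :
  (forall j, p j -> N (f j)) -> N (\sum_(j <- s | p j) f j).
Proof.
move=> Nf; elim/big_ind: _ => //; [exact: submod0 | exact: submodD].
Qed.

Lemma span_list (s : seq M) x : lspan (fun y => y \in s) x ->
  exists c : 'I_(size s) -> K, x = \sum_k c k *: s`_k.
Proof.
pose N0 (x : M) := exists c : 'I_(size s) -> K, x = \sum_k c k *: s`_k.
have z : N0 0 by exists (fun=> 0); rewrite big1 // => k _; rewrite scale0r.
have D a b : N0 a -> N0 b -> N0 (a + b).
  move=> [c ->] [c' ->]; exists (fun k => c k + c' k).
  by rewrite -big_split; apply: eq_bigr => k _; rewrite scalerDl.
have Z l a : N0 a -> N0 (l *: a).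
  move=> [c ->]; exists (fun k => l * c k).
  by rewrite scaler_sumr; apply: eq_bigr => k _; rewrite scalerA.
apply: (@span_min _ (Submodule z D Z)) => y ys /=.
have hi : (index y s < size s)%N by rewrite index_mem.
exists (fun k => (k == Ordinal hi)%:R).
rewrite (bigD1 (Ordinal hi)) //= eqxx scale1r nth_index // big1 ?addr0 //.
by move=> k /negPf ->; rewrite scale0r.
Qed.
End SpanTheory.

Section LinearMaps.
Variables (K : pzRingType) (M N : lmodType K) (f : M -> N).
Hypothesis f_linear : linear f.

Lemma map_linD x y : f (x + y) = f x + f y.
Proof. by have := f_linear 1 x y; rewrite !scale1r. Qed.
Lemma map_lin0 : f 0 = 0.
Proof. by apply: (addrI (f 0)); rewrite -map_linD !addr0. Qed.
Lemma map_linZ c x : f (c *: x) = c *: f x.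
Proof. by have := f_linear c x 0; rewrite map_lin0 !addr0. Qed.
End LinearMaps.

Section LinearForms.
Variables (K : pzRingType) (M : lmodType K) (f : M -> K).
Hypothesis f_linear : scalar f.

Lemma formD x y : f (x + y) = f x + f y.
Proof. exact: (map_linD (N := K^o) f_linear). Qed.
Lemma form0 : f 0 = 0.
Proof. exact: (map_lin0 (N := K^o) f_linear). Qed.
Lemma formZ c x : f (c *: x) = c * f x.
Proof. exact: (map_linZ (N := K^o) f_linear). Qed.
End LinearForms.

(** * Weight spaces *)

Section Weights.
Variables (F : fieldType) (d : qaff_datum F).
Local Notation I := 'I_(rk d).
Local Notation h := (hspace (qreal d)).
Local Notation q := (qq (qpar d)).
Local Notation qp := (qpow (qpar d)).
Local Notation weight := (weight d).

Lemma qpow0 : qp 0 = 1.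
Proof.
apply: (mulIf (qq_neq0 (qpar d))).
by rewrite -{1}qpow1 -qpowD add0r qpow1 mul1r.
Qed.

Lemma qpowN_mul s : qp s * qp (- s) = 1.
Proof. by rewrite -qpowD subrr qpow0. Qed.

Lemma qpowMn s n : qp (s *+ n) = qp s ^+ n.
Proof.
by elim: n => [|n ih]; rewrite ?qpow0 ?expr0 // mulrS qpowD ih exprS.
Qed.

Lemma qpow_nat_neq1 n : (0 < n)%N -> qp n%:R != 1.
Proof. by move=> n0; rewrite qpowMn qpow1 qq_nonroot. Qed.

(** If s = n / m then qpow s ^ m = q ^ n, and q is not a root of unity. *)
Lemma qpow_eq1 s : qp s = 1 -> s = 0.
Proof.
move=> s1.
have den : qp (numq s)%:~R = 1.
  rewrite -[s in numq s]divq_num_den.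
  have -> : (numq ((numq s)%:~R / (denq s)%:~R))%:~R = s *+ `|denq s|%N.
    rewrite divq_num_den -mulr_natr natr_absz ger0_norm ?denq_ge0 //.
    by rewrite -{2}[s]divq_num_den divfK // intr_eq0 denq_neq0.
  by rewrite qpowMn s1 expr1n.
apply/eqP; rewrite -numq_eq0; apply/negPn/negP => n0.
case: (numq s) n0 den => n; last first.
  rewrite NegzE rmorphN /= => _ nm1; have := qpowN_mul n.+1%:R.
  rewrite nm1 mulr1 => /eqP; apply/negP; exact: qpow_nat_neq1.
by move=> n0 /eqP; apply/negP/qpow_nat_neq1; case: n n0.
Qed.

Lemma weight_sep (w w' : weight) : w != w' -> exists t, qp (w t) != qp (w' t).
Proof.
move=> /eqP ww'; apply: contrapT => nex; apply: ww'; apply/lfunP => t.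
apply/eqP; rewrite -subr_eq0; apply/eqP/qpow_eq1.
have /eqP e : qp (w t) == qp (w' t).
  by apply/negPn/negP => ne; apply: nex; exists t.
by rewrite qpowD e qpowN_mul.
Qed.

Definition cone (lam : weight) (c : I -> nat) : weight :=
  lam - \sum_i (alpha (qreal d) i : weight) *+ c i.

Lemma alpha_indep (a : I -> rat) :
  \sum_i a i *: (alpha (qreal d) i : weight) = 0 -> forall i, a i = 0.
Proof.
move=> a0 i; have := alpha_free (qreal d).
have sz : size [seq alpha (qreal d) j | j : I] == rk d.
  by rewrite size_image card_ord.
pose T := Tuple sz => frT.
have /freeP fr : free T by exact: frT.
apply: (fr a); rewrite -[RHS]a0; apply: eq_bigr => j _; congr (_ *: _).
rewrite (nth_map j) ?size_enum_ord //.
by congr alpha; apply: val_inj; rewrite /= nth_enum_ord.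
Qed.

Lemma cone_inj lam c c' : cone lam c = cone lam c' -> c =1 c'.
Proof.
move=> /addrI/oppr_inj e i.
have /alpha_indep/(_ i)/eqP : \sum_i ((c i)%:R - (c' i)%:R : rat) *:
    (alpha (qreal d) i : weight) = 0.
  apply/eqP; under eq_bigr do rewrite scalerBl !scaler_nat.
  by rewrite sumrB e subrr.
by rewrite subr_eq0 eqr_nat => /eqP.
Qed.

Lemma cone0 lam c : (forall i, c i = 0)%N -> cone lam c = lam.
Proof. by move=> c0; rewrite /cone big1 ?subr0 // => i _; rewrite c0. Qed.

Lemma coneD lam lam' c c' :
  cone (lam + lam') (fun i => c i + c' i)%N = cone lam c + cone lam' c'.
Proof.
rewrite /cone; under eq_bigr do rewrite mulrnDr.
by rewrite big_split /= opprD addrACA.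
Qed.

Lemma sum_alpha_delta i n :
  \sum_j (alpha (qreal d) j : weight) *+ ((j == i) * n)%N = alpha _ i *+ n.
Proof.
rewrite (bigD1 i) //= eqxx mul1n big1 ?addr0 // => j /negPf ->.
by rewrite mul0n.
Qed.

Lemma cone_addn lam c i n :
  cone lam (fun j => c j + (j == i) * n)%N = cone lam c - alpha _ i *+ n.
Proof.
rewrite /cone; under eq_bigr do rewrite mulrnDr.
by rewrite big_split /= sum_alpha_delta opprD addrA.
Qed.

Section WeightSpaces.
Variables (K : fieldType) (iota : {rmorphism F -> K}) (M : lmodType K).
Variable k : h -> M -> M.
Hypothesis k_linear : forall t, linear (k t).

(** The torus acts through an arbitrary family k of linear maps: this covers
    modules over F, modules over F(u), and factors of a tensor product on which
    no action of the whole algebra is at hand. *)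
Definition wsp (w : weight) (x : M) := forall t, k t x = iota (qp (w t)) *: x.

Lemma wsp0 w : wsp w 0.
Proof. by move=> t; rewrite (map_lin0 (k_linear t)) scaler0. Qed.
Lemma wspD w x y : wsp w x -> wsp w y -> wsp w (x + y).
Proof. by move=> wx wy t; rewrite (map_linD (k_linear t)) wx wy scalerDr. Qed.
Lemma wspZ w c x : wsp w x -> wsp w (c *: x).
Proof.
by move=> wx t; rewrite (map_linZ (k_linear t)) wx !scalerA mulrC.
Qed.
Definition wsp_submod w := Submodule (wsp0 w) (wspD (w:=w)) (wspZ (w:=w)).

(** A product of operators k_t - q^(w'(t)), one for each w' in the list, with t
    chosen such that w and w' differ on t. *)
Lemma weight_detector (ws : seq weight) w : w \notin ws ->
  exists E : M -> M, [/\ linear E,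
    forall w' x, w' \in ws -> wsp w' x -> E x = 0 &
    exists2 e, e != 0 & forall x, wsp w x -> E x = e *: x].
Proof.
elim: ws => [|w0 ws ih] /=.
  exists id; split=> //; exists 1; rewrite ?oner_neq0 // => x.
  by rewrite scale1r.
rewrite inE negb_or => /andP[ww0 /ih [E [Elin E0 [e en0 Ee]]]].
have [t ht] := weight_sep ww0.
pose c0 := iota (qp (w0 t)); exists (fun x => E (k t x - c0 *: x)).
split=> [c x y|w' x|].
- rewrite -Elin (map_linD (k_linear t)) (map_linZ (k_linear t)).
  by rewrite scalerDr opprD addrACA scalerBr !scalerA (mulrC c0).
- rewrite inE => /orP[/eqP -> wx | w'ws wx].
    by rewrite wx subrr (map_lin0 Elin).
  by rewrite wx -scalerBl; apply: (E0 _ _ w'ws); apply: wspZ.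
exists (e * (iota (qp (w t)) - c0)) => [|x wx].
  by rewrite mulf_neq0 // -rmorphB fmorph_eq0 subr_eq0.
by rewrite wx -scalerBl Ee ?scalerA //; apply: wspZ.
Qed.

Lemma weight_sum0 (s : seq (weight * M)) w :
  (forall p, p \in s -> wsp p.1 p.2) -> \sum_(p <- s) p.2 = 0 ->
  \sum_(p <- s | p.1 == w) p.2 = 0.
Proof.
move=> ws s0; pose ws' := [seq p.1 | p <- s & p.1 != w].
have /weight_detector [E [Elin E0 [e en0 Ee]]] : w \notin ws'.
  apply/negP; case/mapP => p; rewrite mem_filter => /andP[ne _] e.
  by rewrite e eqxx in ne.
have: E (\sum_(p <- s) p.2) = e *: \sum_(p <- s | p.1 == w) p.2.
  rewrite (big_morph E (map_linD Elin) (map_lin0 Elin)) (bigID (fun p => p.1 ==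
    w)) /=.
  rewrite [X in _ + X]big_seq_cond [X in _ + X]big1; last first.
    move=> p /andP[ps pw]; apply: (E0 p.1); last exact: ws.
    by apply: map_f; rewrite mem_filter pw.
  rewrite addr0 scaler_sumr big_seq_cond [RHS]big_seq_cond.
  by apply: eq_bigr => p /andP[/ws wp /eqP pw]; apply: Ee; rewrite -pw.
by rewrite s0 (map_lin0 Elin) => /esym/eqP;
  rewrite scaler_eq0 (negPf en0) => /eqP.
Qed.

Lemma span_union (T : weight -> M -> Prop) x :
  lspan (fun y => exists w, T w y) x -> exists s : seq (weight * M),
    (forall p, p \in s -> lspan (T p.1) p.2) /\ x = \sum_(p <- s) p.2.
Proof.
pose N0 (x : M) := exists s : seq (weight * M),
    (forall p, p \in s -> lspan (T p.1) p.2) /\ x = \sum_(p <- s) p.2.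
have z : N0 0 by exists [::]; rewrite big_nil.
have D a b : N0 a -> N0 b -> N0 (a + b).
  move=> [s [hs ->]] [s' [hs' ->]]; exists (s ++ s'); rewrite big_cat.
  by split=> // p; rewrite mem_cat => /orP[/hs|/hs'].
have Z l a : N0 a -> N0 (l *: a).
  move=> [s [hs ->]]; exists [seq (p.1, l *: p.2) | p <- s].
  rewrite big_map scaler_sumr; split=> // p /mapP[p' /hs hp' ->].
  exact: submodZ.
apply: (@span_min _ _ _ (Submodule z D Z)) => y [w wy].
exists [:: (w, y)]; rewrite big_seq1; split=> // p; rewrite inE => /eqP -> /=.
exact: mem_span.
Qed.

(** A sum of subspaces of the weight spaces is graded, because the sum of the
    weight spaces is direct. Most weight arguments below are instances with a
    suitable T. *)
Lemma weight_component (T : weight -> M -> Prop) w x :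
  (forall w y, T w y -> wsp w y) ->
  lspan (fun y => exists w, T w y) x -> wsp w x -> lspan (T w) x.
Proof.
move=> Tw /span_union [s [hs ->]] wx.
set y := \sum_(p <- s) p.2 in wx *.
have hw p : p \in (w, - y) :: s -> wsp p.1 p.2.
  rewrite inE => /orP[/eqP -> /= |/hs]; first by rewrite -scaleN1r; apply: wspZ.
  by apply: (@span_min _ _ _ (wsp_submod p.1)); apply: Tw.
have := weight_sum0 w hw; rewrite big_cons addNr big_cons /= eqxx.
move=> /(_ erefl)/eqP; rewrite addrC subr_eq0 => /eqP <-.
rewrite big_seq_cond; apply: (@submod_sum _ _ (lspan (T w))) => p.
by move=> /andP[ps /eqP <-]; exact: hs.
Qed.

Lemma weight_in_cone lam :
  (forall x, lspan (fun y => exists n, wsp (cone lam n) y) x) ->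
  forall w x, wsp w x -> x != 0 -> exists n, w = cone lam n.
Proof.
move=> M_span w x wx /eqP xn0; apply: contrapT => nw; apply: xn0.
pose T w' y := (exists n, w' = cone lam n) /\ wsp w' y.
have Tx : lspan (fun y => exists w, T w y) x.
  apply: span_mono (M_span x) => y [n yn].
  by apply: mem_span; exists (cone lam n); split=> //; exists n.
apply: span_eq0 (weight_component (fun _ _ => @proj2 _ _) Tx wx).
by move=> y [].
Qed.
End WeightSpaces.

End Weights.

(** * The action of the generators *)

Section ExpClosed.
Variables (F : fieldType) (A : lalgType F) (P : A -> Prop).
Hypothesis P0 : P 0.
Hypothesis PD : forall x y, P x -> P y -> P (x + y).
Hypothesis PM : forall x y, P x -> P y -> P (x * y).
Hypothesis PZ : forall c x, P x -> P (c *: x).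

Lemma closed_sum n (f : 'I_n -> A) : (forall l, P (f l)) -> P (\sum_l f l).
Proof. by move=> Pf; elim/big_ind: _. Qed.

Lemma fps_exp_closed (a : nat -> A) n :
  P 1 -> (forall k, P (a k)) -> P (fps_exp a n).
Proof.
move=> P1 Pa; apply: closed_sum => l; apply: PZ.
have Pit k m : P (iter k (fps_mul a) (@fps_one F A) m); last exact: Pit.
elim: k m => [|k ih] m /=.
  by rewrite /fps_one; case: eqP.
by apply: closed_sum => j; apply: PM; [exact: Pa | exact: ih].
Qed.

(** The n-th coefficient of exp(a) is a_n plus a polynomial in the a_k, k < n:
    this is what makes h_{i,m} a polynomial in the phi_{i,p}. *)
Lemma fps_exp_lead (a : nat -> A) n : P 1 -> a 0%N = 0 ->
  (forall k, (k < n)%N -> P (a k)) -> (0 < n)%N ->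
  exists2 R, P R & fps_exp a n = a n + R.
Proof.
move=> P1 a0 Pa n0; case: n n0 Pa => // n _ Pa.
have iter0 k : iter k.+1 (fps_mul a) (@fps_one F A) 0%N = 0.
  by rewrite /= /fps_mul big_ord1 a0 mul0r.
have Pit k m : (m < n.+1)%N -> P (iter k (fps_mul a) (@fps_one F A) m).
  elim: k m => [|k ih] m mn /=; first by rewrite /fps_one; case: eqP.
  apply: closed_sum => j; apply: PM.
    by apply: Pa; apply: leq_trans (ltn_ord j) _.
  by apply: ih; apply: leq_ltn_trans (leq_subr _ _) mn.
(* in a_j (a^(k+1))_(n+1-j), the factor a_j with j = n+1 meets the constant
   term of a^(k+1), which is zero *)
have Pit2 k : P (iter k.+2 (fps_mul a) (@fps_one F A) n.+1).
  rewrite iterS {1}/fps_mul big_ord_recr subnn iter0 mulr0 /= addr0;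
    apply: closed_sum => j.
  case: (posnP j) => [-> | j0]; first by rewrite a0 mul0r.
  apply: PM; first by apply: Pa.
  apply: (Pit k.+1); rewrite ltnS leq_subLR.
  by case: (nat_of_ord j) j0 => // j' _; rewrite addSn ltnS leq_addl.
rewrite /fps_exp big_ord_recl big_ord_recl /= /fps_one /= scaler0 add0r.
have -> : fps_mul a (@fps_one F A) n.+1 = a n.+1.
  rewrite /fps_mul big_ord_recr /= subnn /fps_one eqxx mulr1 big1 ?add0r // =>
    j _.
  by rewrite subn_eq0 leqNgt ltn_ord mulr0.
rewrite [in X in X *: _]factS fact0 invr1 scale1r.
by eexists; last reflexivity; apply: closed_sum => k; apply/PZ/Pit2.
Qed.
End ExpClosed.

Lemma malgUZ (T : choiceType) (F : fieldType) (m : T) (c : F) :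
  << c *g m >> = c *: << m >> :> {malg F[T]}.
Proof. by apply/malgP => m'; rewrite mcoeffZ !mcoeffU mulrnAr mulr1. Qed.

Section FreeMonomials.
Variables (T : choiceType) (F : fieldType).

Lemma malg_fmonom_nil : << FMonom [::] >> = 1 :> {malg F[{fmonom T}]}.
Proof. by congr mkmalgU; apply: val_inj; rewrite /= fm1. Qed.

Lemma malg_fmonom_cons (g : T) s :
  << FMonom (g :: s) >> = << fmu g >> * << FMonom s >> :> {malg F[{fmonom T}]}.
Proof.
rewrite malgM_def fgmulUU mulr1; congr (mkmalgU _ _).
by apply: val_inj; rewrite /= fmM fmuE.
Qed.
End FreeMonomials.

Lemma freealg_ind (F : fieldType) (d : qaff_datum F) (P : freealg d -> Prop) :
  P 0 -> P 1 -> (forall x y, P x -> P y -> P (x + y)) ->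
  (forall x y, P x -> P y -> P (x * y)) -> (forall c x, P x -> P (c *: x)) ->
  (forall g, P (fgen g)) -> forall a, P a.
Proof.
move=> P0 P1 PD PM PZ Pg a; rewrite [a]monalgE; elim/big_ind: _ => // m _.
rewrite malgUZ; apply: PZ; case: m => s; elim: s => [|g s ih].
  by rewrite malg_fmonom_nil.
by rewrite malg_fmonom_cons; apply: PM; [exact: Pg | exact: ih].
Qed.

Section UStable.
Variables (F : fieldType) (d : qaff_datum F) (K : fieldType).
Variables (iota : {rmorphism F -> K}) (M : Umod d iota).
Local Notation act := (@Uact F d K iota M).

Lemma act_linear g : linear (act g).
Proof. by move=> c x y; exact: Uact_linear (Uact_axiom M) g c x y. Qed.
Lemma actZ g c x : act g (c *: x) = c *: act g x.
Proof. exact: map_linZ (act_linear g) c x. Qed.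
Lemma actB g x y : act g (x - y) = act g x - act g y.
Proof. exact: (additive_linear (act_linear g)). Qed.
Lemma act0 g : act g 0 = 0.
Proof. exact: map_lin0 (act_linear g). Qed.
Lemma actD g x y : act g (x + y) = act g x + act g y.
Proof. exact: map_linD (act_linear g) x y. Qed.

Lemma act_one x : act 1 x = x. Proof. exact: Uact1 (Uact_axiom M) x. Qed.
Lemma actM g g' x : act (g * g') x = act g (act g' x).
Proof. exact: UactM (Uact_axiom M) g g' x. Qed.
Lemma actDl g g' x : act (g + g') x = act g x + act g' x.
Proof. exact: UactD (Uact_axiom M) g g' x. Qed.
Lemma actZl c g x : act (c *: g) x = iota c *: act g x.
Proof. exact: UactZ (Uact_axiom M) c g x. Qed.
Lemma actNl g x : act (- g) x = - act g x.
Proof. by rewrite -[- g]scaleN1r actZl rmorphN1 scaleN1r. Qed.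
Lemma actBl g g' x : act (g - g') x = act g x - act g' x.
Proof. by rewrite actDl actNl. Qed.
Lemma act0l x : act 0 x = 0.
Proof. by rewrite -[X in act X _](scale0r (0 : Uq d)) actZl rmorph0 scale0r.
  Qed.

Lemma Uq_piD a b : Uq_pi (a + b) = Uq_pi a + Uq_pi b :> Uq d.
Proof. exact: linearD. Qed.
Lemma Uq_piZ c a : Uq_pi (c *: a) = c *: Uq_pi a :> Uq d.
Proof. exact: linearZ. Qed.
Lemma Uq_pi0 : Uq_pi 0 = 0 :> Uq d.
Proof. by have := Uq_piZ 0 0; rewrite !scale0r. Qed.
Lemma Uq_piM a b : Uq_pi (a * b) = Uq_pi a * Uq_pi b :> Uq d.
Proof. exact: presented_pi_mul. Qed.
Lemma Uq_piB a b : Uq_pi (a - b) = Uq_pi a - Uq_pi b :> Uq d.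
Proof. by rewrite Uq_piD -scaleN1r Uq_piZ scaleN1r. Qed.
Lemma Uq_pi_rel a b : qrel a b -> Uq_pi a = Uq_pi b :> Uq d.
Proof. exact: presented_rel. Qed.

Section Stable.
Variable S : M -> Prop.
Hypothesis S0 : S 0.
Hypothesis SD : forall x y, S x -> S y -> S (x + y).
Hypothesis SZ : forall c x, S x -> S (iota c *: x).

(** Elements of the free algebra that map S into itself form a subalgebra, so
    S is stable under Uq as soon as it is stable under the generators. *)
Definition preserves (a : freealg d) := forall x, S x -> S (act (Uq_pi a) x).
Lemma preserves0 : preserves 0.
Proof. by move=> x Sx; rewrite Uq_pi0 act0l. Qed.
Lemma preserves1 : preserves 1.
Proof. by move=> x Sx; rewrite act_one. Qed.
Lemma preservesD a b : preserves a -> preserves b -> preserves (a + b).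
Proof. by move=> sa sb x Sx; rewrite Uq_piD actDl; apply: SD; auto. Qed.
Lemma preservesM a b : preserves a -> preserves b -> preserves (a * b).
Proof. by move=> sa sb x Sx; rewrite Uq_piM actM; auto. Qed.
Lemma preservesZ c a : preserves a -> preserves (c *: a).
Proof. by move=> sa x Sx; rewrite Uq_piZ actZl; auto. Qed.

Lemma preserves_act : (forall g, preserves (fgen g)) -> forall g x, S x -> S
  (act g x).
Proof.
move=> sg g x Sx; have [a ->] := presented_pi_surj g.
apply: (freealg_ind (P := preserves)) Sx => //.
- exact: preserves0.
- exact: preserves1.
- exact: preservesD.
- exact: preservesM.
- exact: preservesZ.
Qed.
End Stable.
End UStable.

Section Generators.
Variables (F : fieldType) (d : qaff_datum F).
Local Notation I := 'I_(rk d).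
Local Notation q := (qq (qpar d)).

Lemma fH0 (i : I) : fH i 0 = 0 :> freealg d.
Proof. by rewrite /fH; case: insubP. Qed.

Lemma fgen_h (i : I) (m : {m : int | m != 0}) :
  fgen (inr (i, m)) = fH i (val m) :> freealg d.
Proof. by rewrite /fH valK. Qed.

Lemma fphiE b (i : I) m : fphi b i m =
  fK (alphav _ i *~ (sgb b * (symmz i)%:Z)) *
  fps_exp (fun j => ((sgb b)%:~R * (q - q^-1)) *: fH i (sgb b * j%:Z)) m.
Proof. by []. Qed.

Lemma fphizE b (i : I) (m : int) : fphiz b i m =
  (if 0 <= sgb b * m then fphi b i `|m|%N else 0) :> freealg d.
Proof. by []. Qed.
End Generators.

Local Opaque fgen fX fK fH fphi fphiz.

Section Relations.
Variables (F : fieldType) (d : qaff_datum F) (K : fieldType).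
Variables (iota : {rmorphism F -> K}) (M : Umod d iota).
Local Notation I := 'I_(rk d).
Local Notation q := (qq (qpar d)).
Local Notation qp := (qpow (qpar d)).
Local Notation act := (@Uact F d K iota M).
Local Notation kact := (fun t => act (Uk d t)).

(** The relations of Uq, as rules to move generators past each other on a
    module. *)
Section GenericRelations.
Implicit Types (a b c : freealg d) (k : F) (x : M).
Let fact a x := act (Uq_pi a) x.

Lemma act_piM a b x : fact (a * b) x = fact a (fact b x).
Proof. by rewrite /fact Uq_piM actM. Qed.
Lemma act_piB a b x : fact (a - b) x = fact a x - fact b x.
Proof. by rewrite /fact Uq_piB actBl. Qed.
Lemma act_piZ k a x : fact (k *: a) x = iota k *: fact a x.
Proof. by rewrite /fact Uq_piZ actZl. Qed.

Lemma act_rel_mul a b c x : qrel (a * b) c -> fact a (fact b x) = fact c x.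
Proof. by move=> /Uq_pi_rel e; rewrite -act_piM /fact e. Qed.
Lemma act_rel_conj a b c k x : qrel (a * b * c) (k *: b) ->
  fact a (fact b (fact c x)) = iota k *: fact b x.
Proof. by move=> /Uq_pi_rel e;
  rewrite -!act_piM /fact e -/(fact _ _) act_piZ. Qed.
Lemma act_rel_comm a b c x : qrel (a * b - b * a) c ->
  fact a (fact b x) = fact b (fact a x) + fact c x.
Proof.
move=> /Uq_pi_rel e; apply/eqP; rewrite addrC -subr_eq -!act_piM -act_piB.
by rewrite /fact e.
Qed.
Lemma act_rel_commZ a b c k x : qrel (a * b - b * a) (k *: c) ->
  fact a (fact b x) = fact b (fact a x) + iota k *: fact c x.
Proof. by move=> /(act_rel_comm x) ->; rewrite act_piZ. Qed.
End GenericRelations.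

Lemma act_kD s t x : act (Uk d s) (act (Uk d t) x) = act (Uk d (s + t)) x.
Proof. exact: act_rel_mul x (qrel_kD s t). Qed.
Lemma act_k0 x : act (Uk d 0) x = x.
Proof. by rewrite /Uk (Uq_pi_rel (qrel_k0 d)) act_one. Qed.

Lemma act_kx b j r t x : act (Uk d t) (act (Ux d b j r) x) =
  iota (qp ((sgb b)%:~R * alpha (qreal d) j t)) *:
    act (Ux d b j r) (act (Uk d t) x).
Proof.
have e : act (Uk d t) (act (Ux d b j r) (act (Uk d (- t)) (act (Uk d t) x))) =
    iota (qp ((sgb b)%:~R * alpha (qreal d) j t)) *:
      act (Ux d b j r) (act (Uk d t) x).
  exact: act_rel_conj (act (Uk d t) x) (qrel_kx b t j r).
by rewrite -e (act_kD (- t) t) addNr act_k0.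
Qed.

Lemma act_hx b i m j r x : m != 0 -> act (Uh d i m) (act (Ux d b j r) x) =
  act (Ux d b j r) (act (Uh d i m) x) +
  iota ((sgb b)%:~R / m%:~R * qint q (m * bmat i j)) *: act (Ux d b j (m + r))
    x.
Proof. by move=> m0; exact: act_rel_commZ x (qrel_hx b i j r m0). Qed.

Lemma act_xx i j r s x : act (Ux d true i r) (act (Ux d false j s) x) =
  act (Ux d false j s) (act (Ux d true i r) x) +
  (if i == j then iota (qi d i - (qi d i)^-1)^-1 *:
     (act (Uq_pi (fphiz true i (r + s))) x -
      act (Uq_pi (fphiz false i (r + s))) x) else 0).
Proof.
have := qrel_xx i j r s; case: eqP => _ e.
  by rewrite [LHS](act_rel_commZ x e) act_piB.
by rewrite [LHS](act_rel_comm x e) Uq_pi0 act0l.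
Qed.

Lemma wsp_raise w i r x : wsp iota kact w x ->
  wsp iota kact (w + alpha _ i) (act (Ux d true i r) x).
Proof.
move=> wx t; rewrite act_kx wx actZ scalerA -rmorphM -qpowD mul1r.
by rewrite addrC lfunE.
Qed.

Lemma wsp_lower w i r x : wsp iota kact w x ->
  wsp iota kact (w - alpha _ i) (act (Ux d false i r) x).
Proof.
move=> wx t; rewrite act_kx wx actZ scalerA -rmorphM -qpowD.
by rewrite addrC !lfunE /= lfunE /= mulN1r.
Qed.
End Relations.

(** * Highest weight vectors and words in the x^- *)

Section Words.
Variables (F : fieldType) (d : qaff_datum F) (K : fieldType).
Variables (iota : {rmorphism F -> K}) (M : Umod d iota).
Local Notation I := 'I_(rk d).
Local Notation q := (qq (qpar d)).
Local Notation qp := (qpow (qpar d)).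
Local Notation act := (@Uact F d K iota M).
Local Notation kact := (fun t => act (Uk d t)).

(** A is F itself for a module over F, and the ring of fractions regular at
    u = 1 for the fusion module. *)
Variable A : K -> Prop.
Hypothesis AC : forall c, A (iota c).
Hypothesis AD : forall x y, A x -> A y -> A (x + y).
Hypothesis AM : forall x y, A x -> A y -> A (x * y).

Variables (lam : weight d) (v : M).
Hypothesis v_x : forall i r, act (Ux d true i r) v = 0.
Hypothesis v_k : wsp iota kact lam v.
Hypothesis v_phi : forall b i m, exists2 c, A c & act (Uphi d b i m) v = c *: v.

Let A0 : A 0. Proof. by have := AC 0; rewrite rmorph0. Qed.
Let A1 : A 1. Proof. by have := AC 1; rewrite rmorph1. Qed.

Let oppr_iota (x : M) : - x = iota (-1) *: x.
Proof. by rewrite rmorphN1 scaleN1r. Qed.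

Definition vline (x : M) := exists2 c, A c & x = c *: v.

Lemma vline_closed : [/\ vline 0, forall x y, vline x -> vline y -> vline (x +
  y)
  & forall c x, vline x -> vline (iota c *: x)].
Proof.
split=> [|x y [a Aa ->] [b Ab ->]|c x [a Aa ->]].
- by exists 0; rewrite ?scale0r.
- by exists (a + b); rewrite ?scalerDl //; apply: AD.
- by exists (iota c * a); rewrite ?scalerA //; apply: AM.
Qed.

Lemma q_sub_neq0 : q - q^-1 != 0.
Proof.
have qn0 := qq_neq0 (qpar d); apply/eqP => e.
have /eqP : q ^+ 2 = 1 by rewrite expr2 -{2}[q](subrK q^-1) e add0r mulfV.
by apply/negP/qq_nonroot.
Qed.

(** The hypotheses are on the phi_{i,m}; those on the h_{i,m} follow by
    induction on m, as phi_{i,m} is k (c h_{i,m} + R) with c nonzero and R a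
    polynomial in the h_{i,p}, p < m. *)
Lemma vline_h b i n : preserves vline (fH i (sgb b * n%:Z)).
Proof.
have [L0 LD LZ] := vline_closed.
have sD := preservesD LD; have sM := @preservesM _ _ _ _ _ vline;
  have sZ := preservesZ LZ.
elim/ltn_ind: n => n ih; case: (posnP n) => [-> | n0].
  by rewrite mulr0 fH0; apply: preserves0.
pose a j := ((sgb b)%:~R * (q - q^-1)) *: fH i (sgb b * j%:Z) : freealg d.
have a0 : a 0%N = 0.
  by rewrite /a mulr0 fH0 scaler0.
have [R sR eR] := fps_exp_lead (preserves0 L0) sD sM sZ (@preserves1 _ _ _ _ _
  _) a0
  (fun k kn => sZ _ _ (ih k kn)) n0.
have cn0 : (sgb b)%:~R * (q - q^-1) != 0.
  rewrite mulf_neq0 ?q_sub_neq0 // /sgb; case: b {ih a a0 R sR eR}.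
    by rewrite oner_neq0.
  by rewrite rmorphN1 oppr_eq0 oner_neq0.
suff sa : preserves vline (a n).
  by rewrite -[fH _ _]scale1r -(mulVf cn0) -scalerA; apply: sZ.
move=> x [c Ac ->].
set t := alphav (qreal d) i *~ (sgb b * (symmz i)%:Z).
have -> : act (Uq_pi (a n)) (c *: v) =
    act (Uk d (- t)) (act (Uphi d b i n) (c *: v)) -
    act (Uq_pi R) (c *: v).
  have -> : act (Uphi d b i n) (c *: v) =
      act (Uk d t) (act (Uq_pi (a n + R)) (c *: v)).
    by rewrite -eR -act_piM -fphiE.
  by rewrite (act_kD (- t) t) addNr act_k0 Uq_piD actDl addrK.
apply: LD.
  rewrite actZ; have [c' Ac' ->] := v_phi b i n.
  rewrite actZ actZ v_k !scalerA; exists (c * c' * iota (qp (lam (- t)))) => //.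
  by apply: AM => //; apply: AM.
rewrite oppr_iota; apply: LZ; apply: sR; by exists c.
Qed.

Inductive word : (I -> nat) -> M -> Prop :=
| word_nil : word (fun=> 0%N) v
| word_cons i r n x : word n x ->
    word (fun j => n j + (j == i) * 1)%N (act (Ux d false i r) x).

Lemma word_wsp n x : word n x -> wsp iota kact (cone lam n) x.
Proof.
elim=> {n x} [|i r n x _ wx]; first by rewrite cone0.
by rewrite cone_addn; apply: wsp_lower.
Qed.

Lemma word_act n x : word n x -> exists g, x = act g v.
Proof.
elim=> {n x} [|i r n x _ [g ->]]; first by exists 1; rewrite act_one.
by exists (Ux d false i r * g); rewrite actM.
Qed.

Lemma word_top n x : word n x -> n =1 (fun=> 0%N) -> x = v.
Proof. by case=> // i r c y _ /(_ i); rewrite eqxx addn1. Qed.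

Inductive word_span : M -> Prop :=
| word_span0 : word_span 0
| word_span_cons c n x y : A c -> word n x -> word_span y ->
    word_span (c *: x + y).

Lemma word_spanD x y : word_span x -> word_span y -> word_span (x + y).
Proof.
elim=> {x} [|c n x z Ac wx _ ih] wy; first by rewrite add0r.
by rewrite -addrA; apply: word_span_cons wx _ => //; apply: ih.
Qed.
Lemma word_spanZ c x : A c -> word_span x -> word_span (c *: x).
Proof.
move=> Ac; elim=> {x} [|c' n x z Ac' wx _ ih]; first by rewrite scaler0; left.
rewrite scalerDr scalerA; apply: word_span_cons wx ih; exact: AM.
Qed.
Lemma word_spanZF c x : word_span x -> word_span (iota c *: x).
Proof. exact: word_spanZ. Qed.
Lemma word_span_word n x : word n x -> word_span x.
Proof.
move=> wx; rewrite -[x]scale1r -[_ *: _]addr0; apply: word_span_cons wx _ => //.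
exact: word_span0.
Qed.

Lemma word_span_act g : (forall n x, word n x -> word_span (act g x)) ->
  forall x, word_span x -> word_span (act g x).
Proof.
move=> wg x; elim=> {x} [|c n x y Ac /wg wx _ ih].
  by rewrite act0; left.
by rewrite actD actZ; apply: word_spanD => //; apply: word_spanZ.
Qed.

Let sD := preservesD word_spanD.
Let sM := @preservesM _ _ _ _ _ word_span.
Let sZ := preservesZ word_spanZF.
Let s0 := @preserves0 _ _ _ _ _ _ word_span0.
Let s1 := @preserves1 _ _ _ _ _ word_span.

Lemma word_span_x i r : preserves word_span (fX false i r).
Proof.
apply: word_span_act => n x /(word_cons i r); exact: word_span_word.
Qed.

Lemma word_span_k t : preserves word_span (fK t).
Proof.
apply: word_span_act => n x wx.
by rewrite [act _ _](word_wsp wx); apply: word_spanZ => //;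
  apply: word_span_word wx.
Qed.

(** Moving h_{i,m} past x^-_{j,r} only creates x^-_{j,m+r}, so h_{i,m} reaches v
    and acts on it by a scalar. *)
Lemma word_span_h i m : m != 0 -> preserves word_span (fH i m).
Proof.
move=> m0; apply: word_span_act => n x; elim=> {n x} [|j r n x wx ih].
  have [b ->] : exists b, m = sgb b * `|m|%N%:Z.
    exists (0 <= m); rewrite /sgb; case: (lerP 0 m) => hm.
      by rewrite mul1r gez0_abs.
    by rewrite mulN1r ltz0_abs // opprK.
  have [c Ac ->] : vline (act (Uq_pi (fH i (sgb b * `|m|%N%:Z))) v).
    by apply: vline_h; exists 1; rewrite ?scale1r.
  by apply: word_spanZ => //; apply: word_span_word word_nil.
rewrite act_hx //; apply: word_spanD; first exact: word_span_x ih.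
by apply: word_spanZF; apply: word_span_word (word_cons _ _ wx).
Qed.

Lemma word_span_phi b i m : preserves word_span (fphi b i m).
Proof.
rewrite fphiE; apply: sM; first exact: word_span_k.
apply: (fps_exp_closed s0 sD sM sZ) => // k; apply: sZ.
have [-> | ne] := eqVneq (sgb b * k%:Z) 0.
  by rewrite fH0.
exact: word_span_h.
Qed.

Lemma word_span_phiz b i m : preserves word_span (fphiz b i m).
Proof. by rewrite fphizE; case: ifP => // _; apply: word_span_phi. Qed.

(** Moving x^+ past an x^- creates phi's, which preserve the span, and x^+ kills
    v. *)
Lemma word_span_raise i r : preserves word_span (fX true i r).
Proof.
apply: word_span_act => n x; elim=> {n x} [|j s n x wx ih].
  by rewrite [act _ _]v_x; left.
rewrite [act _ _]act_xx; apply: word_spanD; first exact: word_span_x ih.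
case: ifP => _; last by left.
have wsx := word_span_word wx.
apply: word_spanZF; apply: word_spanD; first exact: word_span_phiz.
by rewrite oppr_iota; apply/word_spanZF/word_span_phiz.
Qed.

(** The spanning half of the triangular decomposition: U.v = U^-.v. *)
Lemma word_span_gen g : word_span (act g v).
Proof.
apply: preserves_act; last exact: word_span_word word_nil.
- exact: word_span0.
- exact: word_spanD.
- exact: word_spanZF.
move=> [[[[b i] r]|t]|[i m]]; last 2 first.
- exact: word_span_k.
- by rewrite fgen_h; apply: word_span_h (valP m).
by case: b; [exact: word_span_raise | exact: word_span_x].
Qed.
End Words.

(** * Tensor products of graded spaces *)

(** V \otimes_F X up to isomorphism: all that is used of tensors are
    bilinearity, generation by pure tensors, and products of linear forms. *)
Record is_tensor (F K : fieldType) (iota : {rmorphism F -> K}) (V : lmodType F)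
    (X T : lmodType K) (b : V -> X -> T) : Prop := IsTensor {
  tensDl : forall x x' y, b (x + x') y = b x y + b x' y;
  tensDr : forall x y y', b x (y + y') = b x y + b x y';
  tensZl : forall c x y, b (c *: x) y = iota c *: b x y;
  tensZr : forall c x y, b x (c *: y) = c *: b x y;
  tens_gen : forall z, lspan (fun z => exists x y, z = b x y) z;
  tens_form : forall (f : V -> F) (g : X -> K),
    scalar f -> scalar g ->
    exists2 e : T -> K, scalar e & forall x y, e (b x y) = iota (f x) * g y
}.

Section TensorPure.
Variables (F K : fieldType) (iota : {rmorphism F -> K}).
Variables (V : lmodType F) (X : lmodType K).
Local Notation T := (tensor iota V X).
Local Notation "x '⊗' y" := (pure iota x y : T) (at level 40).

Let rel_eq a b : @tensor_rel F K iota V X (a - b) ->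
  lquot_pi (lspan (@tensor_rel F K iota V X)) a = lquot_pi _ b.
Proof. by move=> ab; apply/lquot_piP; apply: mem_span. Qed.

Lemma pureDl x x' y : (x + x') ⊗ y = x ⊗ y + x' ⊗ y.
Proof.
rewrite -lquot_piD; apply: rel_eq; rewrite opprD addrA; exact: tensor_relDl.
Qed.
Lemma pureDr x y y' : x ⊗ (y + y') = x ⊗ y + x ⊗ y'.
Proof.
rewrite -lquot_piD; apply: rel_eq; rewrite opprD addrA; exact: tensor_relDr.
Qed.
Lemma pureZl c x y : (c *: x) ⊗ y = iota c *: (x ⊗ y).
Proof. by rewrite -[RHS]linearZ; apply: rel_eq; apply: tensor_relZl. Qed.
Lemma pureZr c x y : x ⊗ (c *: y) = c *: (x ⊗ y).
Proof. by rewrite -[RHS]linearZ; apply: rel_eq; apply: tensor_relZr. Qed.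

Lemma pure_gen (z : T) : lspan (fun z => exists x y, z = x ⊗ y) z.
Proof.
rewrite -[z]lquot_piK; set a := repr _; rewrite [a]monalgE linear_sum.
apply: submod_sum => p _; rewrite malgUZ linearZ; apply: submodZ;
  apply: mem_span; exists p.1, p.2.
by case: p.
Qed.

(** The product of f and g on the free module over V * X kills the relations of
    the tensor product. *)
Lemma tensor_form_exists (f : V -> F) (g : X -> K) :
  scalar f -> scalar g ->
  exists2 e : T -> K, scalar e & forall x y, e (x ⊗ y) = iota (f x) * g y.
Proof.
move=> fl gl; pose ev : {malg K[(V * X)%type]} -> K :=
  mmap idfun (fun p => iota (f p.1) * g p.2).
have evD a b : ev (a + b) = ev a + ev b by exact: mmapD.
have evZ c a : ev (c *: a) = c * ev a.
  rewrite /ev (mmapEw (msuppZ_le _ _)) mmapE big_distrr /=.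
  by apply: eq_bigr => p _; rewrite mcoeffZ /= -mulrA.
have evU x y : ev << (x, y) >> = iota (f x) * g y.
  by rewrite /ev mmapU mul1r.
have ev0 : ev 0 = 0 by exact: mmap0.
have evB a b : ev (a - b) = ev a - ev b.
  by rewrite evD -scaleN1r evZ mulN1r.
have kD a b : ev a = 0 -> ev b = 0 -> ev (a + b) = 0.
  by rewrite evD => -> ->; rewrite addr0.
have kZ c a : ev a = 0 -> ev (c *: a) = 0 by rewrite evZ => ->; rewrite mulr0.
have ker a : lspan (@tensor_rel F K iota V X) a -> ev a = 0.
  apply: (@span_min _ _ _ (Submodule ev0 kD kZ)) => {a} _ [x x' y|x y y'|c x
    y|c x y] /=.
  - by rewrite !evB !evU (formD fl) rmorphD mulrDl -addrA -opprD subrr.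
  - by rewrite !evB !evU (formD gl) mulrDr -addrA -opprD subrr.
  - by rewrite evB evZ !evU (formZ fl) rmorphM mulrA subrr.
  - by rewrite evB evZ !evU (formZ gl) mulrCA subrr.
pose e (z : T) := ev (repr (z : Quotient.quot _)).
have eE a : e (lquot_pi _ a) = ev a.
  apply/eqP; rewrite -subr_eq0 -evB; apply/eqP/ker/lquot_piP; exact: lquot_piK.
exists e => [c x y|x y]; last by rewrite eE evU.
by rewrite -[x]lquot_piK -[y]lquot_piK -linearP !eE evD evZ.
Qed.

Lemma pure_is_tensor : is_tensor iota (fun x y => x ⊗ y).
Proof.
split.
- exact: pureDl.
- exact: pureDr.
- exact: pureZl.
- exact: pureZr.
- exact: pure_gen.
- exact: tensor_form_exists.
Qed.
End TensorPure.

Section TensorSpan.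
Variables (F K : fieldType) (iota : {rmorphism F -> K}).
Variables (V : lmodType F) (X T : lmodType K) (b : V -> X -> T).
Hypothesis bT : is_tensor iota b.

Lemma tens0l y : b 0 y = 0.
Proof. by rewrite -(scale0r (0 : V)) (tensZl bT) rmorph0 scale0r. Qed.
Lemma tens0r x : b x 0 = 0.
Proof. by rewrite -(scale0r (0 : X)) (tensZr bT) scale0r. Qed.

Lemma span_tens (S : V -> Prop) (S' : X -> Prop) x y :
  lspan S x -> lspan S' y ->
  lspan (fun z : T => exists x y, [/\ S x, S' y & z = b x y]) (b x y).
Proof.
move=> Sx S'y; set Q := lspan _.
have D a a' : Q (b a y) -> Q (b a' y) -> Q (b (a + a') y).
  by rewrite (tensDl bT); apply: submodD.
have Z c a : Q (b a y) -> Q (b (c *: a) y).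
  by rewrite (tensZl bT); apply: submodZ.
have O : Q (b 0 y) by rewrite tens0l; apply: submod0.
apply: (@span_min _ _ _ (Submodule O D Z)) Sx => {}x Sx /=.
have D' a a' : Q (b x a) -> Q (b x a') -> Q (b x (a + a')).
  by rewrite (tensDr bT); apply: submodD.
have Z' c a : Q (b x a) -> Q (b x (c *: a)).
  by rewrite (tensZr bT); apply: submodZ.
have O' : Q (b x 0) by rewrite tens0r; apply: submod0.
apply: (@span_min _ _ _ (Submodule O' D' Z')) S'y => {D Z O}{}y S'y /=.
by apply: mem_span; exists x, y.
Qed.

End TensorSpan.

Section GradedSpaces.
Variables (F : fieldType) (d : qaff_datum F).
Local Notation I := 'I_(rk d).
Local Notation h := (hspace (qreal d)).
Local Notation qp := (qpow (qpar d)).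
Local Notation weight := (weight d).

(** The weight conditions that pass to tensor products and to specializations.
    [graded_int] is integrability along alpha_i in a form uniform in the other
    coordinates: each lam - \sum_j n_j alpha_j with n_j <= b for j != i and
    R <= n_i is not a weight. *)
Record graded (K : fieldType) (iota : {rmorphism F -> K}) (M : lmodType K)
    (k : h -> M -> M) (lam : weight) : Prop := Graded {
  graded_linear : forall t, linear (k t);
  graded_span : forall x,
    lspan (fun y => exists n, wsp iota k (cone lam n) y) x;
  graded_fin : forall n, exists s : seq M, forall x,
    wsp iota k (cone lam n) x -> lspan (fun y => y \in s) x;
  graded_int : forall (b : nat) (i : I), exists R : nat, forall n : I -> nat,
    (forall j, j != i -> (n j <= b)%N) -> (R <= n i)%N ->
    forall x, wsp iota k (cone lam n) x -> x = 0
}.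

(** A linear form of weight lam; it vanishes on all other weight spaces. *)
Record top_form (K : fieldType) (iota : {rmorphism F -> K}) (M : lmodType K)
    (k : h -> M -> M) (lam : weight) (f : M -> K) : Prop := TopForm {
  top_linear : scalar f;
  top_k : forall t x, f (k t x) = iota (qp (lam t)) * f x
}.

Lemma top_form_lower (K : fieldType) (iota : {rmorphism F -> K})
    (M : lmodType K) (k : h -> M -> M) lam (f : M -> K) w x :
  top_form iota k lam f -> wsp iota k w x -> w != lam -> f x = 0.
Proof.
move=> tf wx /weight_sep [t wt]; have := top_k tf t x.
rewrite wx (formZ (top_linear tf)) => /eqP.
rewrite -subr_eq0 -mulrBl -rmorphB mulf_eq0.
by rewrite fmorph_eq0 subr_eq0 (negPf wt) => /eqP.
Qed.

Section TensorGraded.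
Variables (K : fieldType) (iota : {rmorphism F -> K}).
Variables (V : lmodType F) (X T : lmodType K) (pr : V -> X -> T).
Hypothesis prT : is_tensor iota pr.
Variables (kV : h -> V -> V) (kX : h -> X -> X) (lamV lamX : weight).
Local Notation "x '⊗' y" := (pr x y) (at level 40).
Variable k : h -> T -> T.
Hypothesis k_lin : forall t, linear (k t).
Hypothesis k_pure : forall t x y, k t (x ⊗ y) = kV t x ⊗ kX t y.
Let idF : {rmorphism F -> F} := idfun.

Lemma wsp_pure w w' x y : wsp idF kV w x -> wsp iota kX w' y ->
  wsp iota k (w + w') (x ⊗ y).
Proof.
move=> wx wy t;
  rewrite k_pure wx wy (tensZl prT) (tensZr prT) scalerA -rmorphM -qpowD.
by rewrite lfunE.
Qed.

Hypothesis gV : graded idF kV lamV.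
Hypothesis gX : graded iota kX lamX.

(** The weight space of weight (lamV + lamX) - N is the sum of the tensor
    products of weight spaces over the decompositions N = n + n'. *)
Lemma tensor_cone_span N z : wsp iota k (cone (lamV + lamX) N) z ->
  lspan (fun z => exists n n' x y, [/\ N =1 (fun i => n i + n' i)%N,
    wsp idF kV (cone lamV n) x, wsp iota kX (cone lamX n') y & z = x ⊗ y]) z.
Proof.
pose U w z := exists n n' x y, [/\ w = cone lamV n + cone lamX n',
    wsp idF kV (cone lamV n) x, wsp iota kX (cone lamX n') y & z = x ⊗ y].
have Uall z' : lspan (fun z => exists w, U w z) z'.
  apply: span_mono (tens_gen prT z') => {z'} _ [x [y ->]].
  apply: span_mono (span_tens prT (graded_span gV x) (graded_span gX y)) =>
    {x y} _ [x [y [[n xn] [n' yn'] ->]]].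
  apply: mem_span.
  by exists (cone lamV n + cone lamX n'), n, n', x, y.
move=> wz; have Uw w y : U w y -> wsp iota k w y.
  by move=> [n [n' [x [x' [-> wx wx' ->]]]]]; apply: wsp_pure.
apply: span_mono (weight_component k_lin Uw (Uall z) wz) => {z wz} z.
move=> [n [n' [x [y [e wx wy ->]]]]]; apply: mem_span; exists n, n', x, y.
by split=> //; move: e; rewrite -coneD; apply: cone_inj.
Qed.

(** A given N has finitely many decompositions n + n', which bounds dimensions;
    and if n_i + n'_i >= R + R' then n_i >= R or n'_i >= R', which gives
    integrability. *)
Lemma graded_tensor : graded iota k (lamV + lamX).
Proof.
split=> //.
- move=> z; apply: span_mono (tens_gen prT z) => {z} _ [x [y ->]].
  apply: span_mono (span_tens prT (graded_span gV x) (graded_span gX y)) =>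
    {x y} _ [x [y [[n xn] [n' yn'] ->]]].
  apply: mem_span.
  exists (fun i => n i + n' i)%N; rewrite coneD; exact: wsp_pure.
- move=> N; have [sV hV] := choice (graded_fin gV).
  have [sX hX] := choice (graded_fin gX).
  pose b := (\max_i N i)%N.
  pose toN (a : {ffun I -> 'I_b.+1}) (i : I) : nat := a i.
  exists (flatten [seq
      [seq x ⊗ y | x <- sV (toN a), y <- sX (fun i => N i - toN a i)%N]
    | a <- enum {: {ffun I -> 'I_b.+1}}]) => z wz.
  apply: span_mono (tensor_cone_span wz) => {z wz} _
    [n [n' [x [y [e wx wy ->]]]]].
  have ble i : (N i <= b)%N by exact: leq_bigmax.
  pose a := [ffun i => inord (n i) : 'I_b.+1].
  have an : toN a = n.
    apply/funext => i;
      rewrite /toN ffunE inordK // ltnS (leq_trans _ (ble i)) //.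
    by rewrite e leq_addr.
  have an' : (fun i => N i - toN a i)%N = n'.
    by apply/funext => i; rewrite an e addKn.
  apply: span_mono (span_tens prT (hV n x wx) (hX n' y wy)) => {x wx y wy} _
    [x [y [xs ys ->]]].
  apply: mem_span; apply/flatten_mapP; exists a.
    by rewrite mem_enum.
  by rewrite an' an; apply/allpairsP; exists (x, y).
- move=> b i; have [R hR] := graded_int gV b i;
  have [R' hR'] := graded_int gX b i.
  exists (R + R')%N => n nb nR z wz.
  apply: span_eq0 (tensor_cone_span wz) => {z wz} _
    [m [m' [x [y [e wx wy ->]]]]].
  have [Rm | mR] := leqP R (m i).
    rewrite (hR m _ Rm x wx) => [|j /nb]; first exact: tens0l prT y.
    by rewrite e; apply: leq_trans (leq_addr _ _).
  rewrite (hR' m' _ _ y wy) => [|j /nb|].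
  + exact: tens0r prT x.
  + by rewrite e; apply: leq_trans (leq_addl _ _).
  + by move: nR; rewrite e => nR;
    rewrite -(leq_add2l R) (leq_trans nR) // leq_add2r ltnW.
Qed.

Lemma top_form_tensor f g : top_form idF kV lamV f -> top_form iota kX lamX g ->
  exists2 e, top_form iota k (lamV + lamX) e &
    forall x y, e (x ⊗ y) = iota (f x) * g y.
Proof.
move=> tf tg.
have [e el eE] := tens_form prT (top_linear tf) (top_linear tg).
exists e => //; split=> // t z.
pose Q x := e (k t x) = iota (qp ((lamV + lamX) t)) * e x.
have Q0 : Q 0 by rewrite /Q (map_lin0 (k_lin t)) (form0 el) mulr0.
have QD x y : Q x -> Q y -> Q (x + y).
  by rewrite /Q (map_linD (k_lin t)) !(formD el) => -> ->; rewrite mulrDr.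
have QZ c x : Q x -> Q (c *: x).
  by rewrite /Q (map_linZ (k_lin t)) !(formZ el) => ->; rewrite mulrCA.
apply: (@span_min _ _ _ (Submodule Q0 QD QZ)) (tens_gen prT z) => _ [x [y ->]]
  /=.
rewrite /Q k_pure !eE (top_k tf) (top_k tg) lfunE qpowD !rmorphM /=.
by rewrite mulrACA.
Qed.
End TensorGraded.

(** The innermost factor F(u) of the fusion module; the torus acts trivially. *)
Section TrivialGraded.
Variables (K : fieldType) (iota : {rmorphism F -> K}).
Let kid (t : h) (x : K^o) : K^o := x.

Lemma cone_eq0 lam (n : I -> nat) i : (0 < n i)%N -> cone lam n != lam.
Proof.
move=> ni; apply/eqP => e; have := @cone_inj _ _ lam n (fun=> 0%N).
by rewrite (@cone0 _ _ lam (fun=> 0%N)) // => /(_ e i) ni0; rewrite ni0 in ni.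
Qed.

Lemma wsp_trivial w (x : K^o) : wsp iota kid w x -> w != 0 -> x = 0.
Proof.
move=> wx /weight_sep [t]; rewrite lfunE qpow0 => wt.
have /eqP := wx t; rewrite -{1}[x]scale1r -subr_eq0 -scalerBl scaler_eq0.
rewrite subr_eq0 -(rmorph1 iota) (inj_eq (fmorph_inj iota)) eq_sym.
by rewrite (negPf wt) => /eqP.
Qed.

Lemma graded_trivial : graded iota kid 0.
Proof.
split=> // [x|n|b i].
- apply: mem_span; exists (fun=> 0%N) => t.
  by rewrite cone0 // lfunE qpow0 rmorph1 scale1r.
- exists [:: 1] => x _; rewrite -[x]mulr1; apply: (@submodZ _ _ _ x (1 : K^o)).
  by apply: mem_span; rewrite inE.
- exists 1%N => n _ ni x wx; apply: wsp_trivial wx _; exact: cone_eq0 ni.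
Qed.

Lemma top_form_trivial : top_form iota kid 0 id.
Proof. by split=> // t x; rewrite lfunE qpow0 rmorph1 mul1r. Qed.
End TrivialGraded.
End GradedSpaces.

(** * l-highest weight modules over F *)

Section HighestWeightModule.
Variables (F : fieldType) (d : qaff_datum F) (V : Fmod d).
Variables (L : lweight d) (v : V).
Hypothesis V_Mod : in_Mod V.
Hypothesis v_high : is_lhighest L v.
Local Notation I := 'I_(rk d).
Local Notation qp := (qpow (qpar d)).
Local Notation idF := (idfun : {rmorphism F -> F}).
Local Notation kact := (fun t (x : V) => Uact (Uk d t) x).
Local Notation lam := (lwt L).
Let A (c : F) := True.

Lemma lh_word_span x : word_span A v x.
Proof.
have [g ->] := lh_gen v_high x.
apply: (word_span_gen (A := A)) (lh_x v_high) (lh_weight v_high) _ g => //.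
by move=> b i m; exists (lpsi L b i m) => //; apply: lh_phi.
Qed.

(** Integrability is assumed separately along each line w + Z alpha_i; only
    finitely many lines occur once the coordinates other than i are bounded. *)
Lemma lh_graded : graded idF kact lam.
Proof.
have k_lin t : linear (kact t) by exact: act_linear.
split=> //.
- move=> x; elim: (lh_word_span x) => {x} [|c n x y _ wx _ ih].
    exact: submod0.
  apply: submodD ih; apply: submodZ; apply: mem_span; exists n.
  by apply: word_wsp wx; exact: lh_weight v_high.
- move=> n; have [m [b [_ bP]]] := Mod_fin_dim V_Mod (cone lam n).
  exists (codom b) => x /bP [a ->]; apply: submod_sum => l _; apply: submodZ.
  by apply: mem_span; apply: codom_f.
- move=> b i.
  pose w (a : {ffun I -> 'I_b.+1}) :=
    cone lam (fun j => if j == i then 0%N else a j).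
  have [R hR] := choice (fun a => Mod_integrable V_Mod (w a) i).
  exists (\max_a R a)%N => n nb nR x.
  pose a := [ffun j => inord (n j) : 'I_b.+1].
  have -> : cone lam n = w a - (alpha (qreal d) i : weight d) *+ n i.
    rewrite -cone_addn; congr (cone _ _); apply/funext => j.
    have [-> | ji] := eqVneq j i; first by rewrite mul1n.
    by rewrite ffunE inordK ?addn0 // ltnS nb.
  by apply: (proj2 (hR a (n i) _ x)); apply: leq_trans nR; apply: leq_bigmax.
Qed.

(** The coefficient of v modulo the sum of the other weight spaces: it exists
    because nonempty words have weights other than lam, and is unique because
    the sum of the weight spaces is direct. *)
Lemma lh_top_form : exists2 f : V -> F, top_form idF kact lam f & f v = 1.
Proof.
have k_lin t : linear (kact t) by exact: act_linear.
pose S := lspan (fun y : V => exists w, w != lam /\ wsp idF kact w y).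
have Sk t x : S x -> S (kact t x).
  have O : S (kact t 0) by rewrite act0; apply: submod0.
  have D a b : S (kact t a) -> S (kact t b) -> S (kact t (a + b)).
    by rewrite actD; apply: submodD.
  have Z c a : S (kact t a) -> S (kact t (c *: a)) by rewrite actZ;
    apply: submodZ.
  apply: (@span_min _ _ _ (Submodule O D Z)) => y [w [wl wy]] /=.
  change (S (Uact (Uk d t) y)); rewrite wy; apply: submodZ; apply: mem_span;
    by exists w.
have Sv a : S (a *: v) -> a = 0.
  pose U w y := w != lam /\ wsp idF kact w y.
  have wv : wsp idF kact lam (a *: v) by apply/wspZ/(lh_weight v_high).
  move=> Sav.
  have := weight_component k_lin (T := U) (fun _ _ p => proj2 p) Sav wv.
  move=> sU; suff : a *: v = 0.
    by move/eqP; rewrite scaler_eq0 (negPf (lh_neq0 v_high)) orbF => /eqP.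
  by apply: span_eq0 sU => y []; rewrite eqxx.
have ex x : exists a, S (x - a *: v).
  elim: (lh_word_span x) => {x} [|c n x y _ wx _ [a Sa]].
    by exists 0; rewrite scale0r subrr; apply: submod0.
  have [n0 | /existsNP [i ni]] := pselect (n =1 (fun=> 0%N)).
    exists (c + a); rewrite (word_top wx n0) scalerDl opprD addrACA subrr add0r.
    exact: Sa.
  exists a; rewrite -addrA; apply: submodD Sa; apply: submodZ; apply: mem_span.
  exists (cone lam n); split; first by apply: (@cone_eq0 _ _ _ _ i);
    rewrite lt0n; apply/eqP.
  by apply: word_wsp wx; exact: lh_weight v_high.
have uniq x a b : S (x - a *: v) -> S (x - b *: v) -> a = b.
  move=> Sa Sb; apply/eqP; rewrite -subr_eq0; apply/eqP/Sv.
  have -> : (a - b) *: v = (x - b *: v) + (-1) *: (x - a *: v).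
    by rewrite scaleN1r opprB [RHS]addrC addrA subrK scalerBl.
  by apply: submodD => //; apply: submodZ.
have [f fP] := choice ex.
exists f; first split.
- move=> c x y; apply: (uniq (c *: x + y)) (fP _) _.
  rewrite scalerDl opprD addrACA -scalerA -scalerBr.
  by apply: submodD => //; apply: submodZ.
- move=> t x; apply: (uniq (kact t x)) (fP _) _.
  have -> : kact t x - (idF (qp (lam t)) * f x) *: v = kact t (x - f x *: v).
    by rewrite actB actZ (lh_weight v_high) scalerA mulrC.
  exact: Sk.
- apply: (uniq v) (fP v) _; rewrite scale1r subrr; exact: submod0.
Qed.
End HighestWeightModule.

(** * Fractions regular at u = 1 *)

Lemma fractionE (R : idomainType) (c : {fraction R}) :
  exists f g, g != 0 /\ c = tofrac f / tofrac g.
Proof.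
elim/quotW: c => x; exists \n_x, \d_x; split; first exact: denom_ratioP.
have d0 : tofrac \d_x != 0 by rewrite tofrac_eq0 denom_ratioP.
apply: (mulIf d0); rewrite divfK //.
rewrite -[LHS]/(FracField.mul (\pi%qT x) (FracField.tofrac \d_x)).
rewrite !piE; apply/eqmodP; rewrite /= FracField.equivfE /FracField.mulf.
by rewrite !numden_Ratio ?mulf_neq0 ?oner_eq0 ?denom_ratioP // !mulr1 mulrC.
Qed.

Lemma div_mul_cancel (K : fieldType) (w t x : K) : w != 0 ->
  t / w * (x * w) = t * x.
Proof. by move=> w0; rewrite mulrCA divfK // mulrC. Qed.

Section Specialize.
Variable F : fieldType.
Local Notation Fu := (Fu F).
Local Notation u := (uvar F).
Local Notation inA := (@in_A F).
Local Notation tf := (@tofrac {poly F}).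

Definition has_value (c : Fu) (a : F) := exists f g : {poly F},
  [/\ g.[1] != 0, c = tf f / tf g & f.[1] = a * g.[1]].

Lemma poly_at1_neq0 (g : {poly F}) : g.[1] != 0 -> g != 0.
Proof. by apply: contra_neq => ->; rewrite horner0. Qed.

Lemma tofrac_neq0 (g : {poly F}) : g.[1] != 0 -> tf g != 0.
Proof. by move/poly_at1_neq0; rewrite tofrac_eq0. Qed.

Lemma value_poly (f : {poly F}) : has_value (tf f) f.[1].
Proof.
by exists f, 1; rewrite hornerC oner_neq0 rmorph1 divr1 mulr1.
Qed.

Lemma value_const a : has_value (const_u F a) a.
Proof. by have := value_poly a%:P; rewrite hornerC. Qed.

Lemma value_u : has_value u 1.
Proof. by have := value_poly 'X; rewrite hornerX. Qed.

Lemma valueD c a c' a' :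
  has_value c a -> has_value c' a' -> has_value (c + c') (a + a').
Proof.
move=> [f [g [g1 -> f1]]] [f' [g' [g'1 -> f'1]]].
exists (f * g' + f' * g), (g * g'); rewrite hornerM mulf_neq0 //; split=> //.
  by rewrite addf_div ?tofrac_neq0 // rmorphD !rmorphM.
by rewrite hornerD !hornerM f1 f'1 mulrDl mulrA; congr (_ + _);
  rewrite -!mulrA [g.[1] * _]mulrC.
Qed.

Lemma valueM c a c' a' :
  has_value c a -> has_value c' a' -> has_value (c * c') (a * a').
Proof.
move=> [f [g [g1 -> f1]]] [f' [g' [g'1 -> f'1]]].
exists (f * f'), (g * g'); rewrite !hornerM mulf_neq0 //; split=> //.
  by rewrite mulf_div !rmorphM.
by rewrite f1 f'1 mulrACA.
Qed.

Lemma valueV c a : a != 0 -> has_value c a -> has_value c^-1 a^-1.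
Proof.
move=> a0 [f [g [g1 -> f1]]]; exists g, f.
rewrite f1 mulf_neq0 //; split=> //; first by rewrite invf_div.
by rewrite mulrA mulVf // mul1r.
Qed.

Lemma value_expu (z : int) : has_value (u ^ z) 1.
Proof.
have vn (n : nat) : has_value (u ^+ n) 1.
  elim: n => [|n ih]; first by rewrite expr0 -(rmorph1 (const_u F));
    apply: value_const.
  by rewrite exprS -[1]mulr1; apply: valueM ih; exact: value_u.
case: z => n; first exact: vn.
by have := valueV (oner_neq0 _) (vn n.+1); rewrite invr1.
Qed.

Lemma value_sum (J : Type) (s : seq J) (c : J -> Fu) (a : J -> F) :
  (forall j, has_value (c j) (a j)) ->
  has_value (\sum_(j <- s) c j) (\sum_(j <- s) a j).
Proof.
move=> ca; elim: s => [|j s ih].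
  by rewrite !big_nil -(rmorph0 (const_u F)); apply: value_const.
by rewrite !big_cons; apply: valueD.
Qed.

Lemma value_div c : has_value c 0 -> exists2 c', inA c' & c = (u - 1) * c'.
Proof.
move=> [f [g [g1 -> f1]]].
have /factor_theorem [f' ->] : root f 1 by rewrite /root f1 mul0r.
exists (tf f' / tf g); first by exists f', g, 0%N, 0%N; rewrite expr0 !divr1.
by rewrite rmorphM rmorphB /= polyC1 rmorph1 [X in X / _]mulrC mulrA.
Qed.

Lemma value_uniq c a a' : has_value c a -> has_value c a' -> a = a'.
Proof.
move=> [f [g [g1 -> f1]]] [f' [g' [g'1 e f'1]]].
have e' : f * g' = f' * g.
  have /eqP : tf f / tf g = tf f' / tf g' by [].
  rewrite eqr_div ?tofrac_neq0 // -!rmorphM /=.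
  by rewrite tofrac_eq => /eqP.
have := congr1 (fun p => p.[1]) e'; rewrite !hornerM f1 f'1.
by rewrite mulrAC -!mulrA [g'.[1] * _]mulrC => /mulIf; apply; rewrite mulf_neq0.
Qed.

Lemma in_A_value c : inA c <-> exists a, has_value c a.
Proof.
split=> [[f [g [a [b [g1 ->]]]]]|[a [f [g [g1 -> f1]]]]]; last first.
  by exists f, g, 0%N, 0%N; rewrite !expr0 !divr1.
exists (f.[1] / g.[1]).
have vdiv (p : {poly F}) n : has_value (tf p / u ^+ n) p.[1].
  rewrite -[p.[1]]mulr1 exprnN.
  by apply: valueM; [apply: value_poly | apply: value_expu].
by apply: valueM => //; apply: valueV.
Qed.

Lemma in_A_const c : inA (const_u F c).
Proof. by apply/in_A_value; exists c; apply: value_const. Qed.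
Lemma in_AD c c' : inA c -> inA c' -> inA (c + c').
Proof.
move=> /in_A_value [a ca] /in_A_value [a' ca']; apply/in_A_value.
by exists (a + a'); apply: valueD.
Qed.
Lemma in_AM c c' : inA c -> inA c' -> inA (c * c').
Proof.
move=> /in_A_value [a ca] /in_A_value [a' ca']; apply/in_A_value.
by exists (a * a'); apply: valueM.
Qed.

Lemma value_split c a : has_value c a ->
  exists2 c', inA c' & c = const_u F a + (u - 1) * c'.
Proof.
move=> ca; have /value_div [c' Ac' e] : has_value (c - const_u F a) 0.
  by rewrite -(subrr a) -rmorphN; apply: valueD => //; apply: value_const.
by exists c' => //; rewrite -e addrC subrK.
Qed.

Lemma um1_not_unit c : inA c -> (u - 1) * c != 1.
Proof.
move=> /in_A_value [a ca]; apply/eqP => e.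
have u1 : has_value (u - 1) 0.
  rewrite -(subrr 1) -(rmorph1 (const_u F)) -rmorphN.
  by apply: valueD value_u (value_const _).
have := valueM u1 ca; rewrite e mul0r -(rmorph1 (const_u F)).
by move=> /(value_uniq (value_const 1))/eqP; rewrite oner_eq0.
Qed.

Lemma common_denominator n (c : 'I_n -> Fu) :
  exists2 t, t != 0 & exists p : 'I_n -> {poly F}, forall l, t * c l = tf (p l).
Proof.
have [f hf] := choice (fun l => fractionE (c l)).
have [g hg] := choice hf.
exists (\prod_l tf (g l)).
  by apply/prodf_neq0 => l _; rewrite tofrac_eq0; case: (hg l).
exists (fun l => f l * \prod_(k | k != l) g k) => l.
have [g0 ->] := hg l; rewrite (bigD1 l) //= rmorphM rmorph_prod /=.
by rewrite [LHS]mulrC -!mulrA mulKf // tofrac_eq0.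
Qed.

(** Divide all polynomials by u - 1 as long as they all vanish at 1; the size of
    the nonzero one decreases. *)
Lemma primitive_at1 n (p : 'I_n -> {poly F}) l0 : p l0 != 0 ->
  exists2 t : Fu, t != 0 & exists p' : 'I_n -> {poly F},
    (forall l, t * tf (p l) = tf (p' l)) /\ exists l, (p' l).[1] != 0.
Proof.
have [m] := ubnP (size (p l0)); elim: m p => // m ih p sp p0.
have [[l pl] | np] := pselect (exists l, (p l).[1] != 0).
  by exists 1; rewrite ?oner_neq0 //; exists p; split=> [k|];
    rewrite ?mul1r //; exists l.
have rp l : exists p', p l = p' * ('X - 1%:P).
  apply/factor_theorem; rewrite /root; apply/negPn/negP => pl.
  by apply: np; exists l.
have [p' hp'] := choice rp.
have p'0 : p' l0 != 0 by apply: contra_neq p0 => e; rewrite hp' e mul0r.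
pose w := tf ('X - 1%:P).
have w0 : w != 0 by rewrite tofrac_eq0 polyXsubC_eq0.
have [|t t0 [p'' [ht hl]]] := ih p' _ p'0.
  by move: sp; rewrite hp' size_Mmonic ?monicXsubC // size_XsubC addn2.
exists (t / w); first exact: mulf_neq0 t0 (invr_neq0 w0).
exists p''; split=> // l; rewrite hp' rmorphM -ht.
exact: div_mul_cancel w0.
Qed.

(** A relation over F(u) can be specialized at u = 1 without becoming
    trivial. *)
Lemma rescale_at1 n (c : 'I_n -> Fu) l0 : c l0 != 0 ->
  exists t : Fu, exists a : 'I_n -> F,
    (forall l, has_value (t * c l) (a l)) /\ exists l, a l != 0.
Proof.
move=> c0; have [t t0 [p hp]] := common_denominator c.
have p0 : p l0 != 0.
  have : tf (p l0) != 0 by rewrite -hp; exact: mulf_neq0 t0 c0.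
  by rewrite tofrac_eq0.
have [t' _ [p' [hp' hl]]] := primitive_at1 p0.
exists (t' * t), (fun l => (p' l).[1]); split=> // l.
by rewrite -mulrA hp hp'; apply: value_poly.
Qed.
End Specialize.

(** * Products of series and Drinfeld polynomials *)

Section Series.
Variable F : fieldType.
Implicit Types (A B P : {poly F}) (f g : nat -> F).

Definition conv f g m : F := \sum_(s < m.+1) f (m - s)%N * g s.

(** The identity A(z) f(z) = B(z) of power series, f(z) = \sum_m f_m z^m. *)
Definition series_eq A f B :=
  forall m, \sum_(a < m.+1) A`_a * f (m - a)%N = B`_m.

(** Up to degree m the series may be replaced by polynomials, whose product is
    associative and commutative. *)
Lemma series_eq_mul A f B A' f' B' : series_eq A f B -> series_eq A' f' B' ->
  series_eq (A * A') (conv f f') (B * B').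
Proof.
move=> e e' m; pose tr (f : nat -> F) := \poly_(k < m.+1) f k.
have tre A0 f0 B0 k :
    series_eq A0 f0 B0 -> (k <= m)%N -> (A0 * tr f0)`_k = B0`_k.
  move=> e0 km; rewrite -e0 coefM; apply: eq_bigr => a _.
  by rewrite coef_poly ltnS (leq_trans (leq_subr _ _) km).
have trconv k : (k <= m)%N -> conv f f' k = (tr f * tr f')`_k.
  move=> km; rewrite coefMr; apply: eq_bigr => a _; rewrite !coef_poly !ltnS.
  by rewrite (leq_trans (leq_subr _ _) km) (leq_trans _ km) // -ltnS.
transitivity (((A * A') * (tr f * tr f'))`_m).
  by rewrite coefM; apply: eq_bigr => a _; rewrite trconv // leq_subr.
rewrite mulrACA !coefM; apply: eq_bigr => a _.
by rewrite (tre _ _ B) ?(tre _ _ B') ?leq_subr // -ltnS.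
Qed.

(** The polynomial P(c z). *)
Definition dilate c P := \poly_(a < size P) (P`_a * c ^+ a).

Lemma coef_dilate c P a : (dilate c P)`_a = P`_a * c ^+ a.
Proof.
by rewrite coef_poly; case: ltnP => // /(nth_default 0) ->; rewrite mul0r.
Qed.

Lemma dilateM c P P' : dilate c (P * P') = dilate c P * dilate c P'.
Proof.
apply/polyP => m; rewrite coef_dilate !coefM mulr_suml; apply: eq_bigr => a _.
rewrite !coef_dilate mulrACA -exprD subnKC //; by rewrite -ltnS.
Qed.

Lemma size_dilate c P : (size (dilate c P) <= size P)%N.
Proof. exact: size_poly. Qed.

(** The polynomial z^n P(1/z), for P of degree at most n. *)
Definition revpoly n P := \poly_(k < n.+1) P`_(n - k).

Lemma coef_revpoly n P k :
  (revpoly n P)`_k = if (k <= n)%N then P`_(n - k) else 0.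
Proof. by rewrite coef_poly ltnS. Qed.

Lemma revpolyD n P P' : revpoly n (P + P') = revpoly n P + revpoly n P'.
Proof.
by apply/polyP => k; rewrite coefD !coef_revpoly coefD; case: ifP;
  rewrite ?addr0.
Qed.
Lemma revpolyZ n c P : revpoly n (c *: P) = c *: revpoly n P.
Proof.
by apply/polyP => k; rewrite coefZ !coef_revpoly coefZ; case: ifP;
  rewrite ?mulr0.
Qed.
Lemma revpoly0 n : revpoly n 0 = 0.
Proof. by apply/polyP => k; rewrite coef_revpoly !coef0 if_same. Qed.
Lemma revpoly_sum n (J : Type) (s : seq J) (f : J -> {poly F}) :
  revpoly n (\sum_(j <- s) f j) = \sum_(j <- s) revpoly n (f j).
Proof. exact: (big_morph (revpoly n) (revpolyD n) (revpoly0 n)). Qed.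
Lemma revpolyXn n a : (a <= n)%N -> revpoly n 'X^a = 'X^(n - a).
Proof.
move=> an; apply/polyP => k; rewrite coef_revpoly !coefXn.
case: leqP => [kn | nk].
  by rewrite -(eqn_add2r k) subnK // -(eqn_add2r a k) subnK // addnC eq_sym.
by case: eqP => // e; move: nk; rewrite e ltnNge leq_subr.
Qed.

Lemma revpolyM n n' P P' : (size P <= n.+1)%N -> (size P' <= n'.+1)%N ->
  revpoly (n + n') (P * P') = revpoly n P * revpoly n' P'.
Proof.
have ex m (Q : {poly F}) :
    (size Q <= m.+1)%N -> Q = \sum_(a < m.+1) Q`_a *: 'X^a.
  move=> sQ; rewrite -poly_def; apply/polyP => k; rewrite coef_poly.
  by case: ltnP => // mk; rewrite nth_default // (leq_trans sQ).
move=> /ex -> /ex ->; rewrite !revpoly_sum !mulr_suml revpoly_sum;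
  apply: eq_bigr => a _.
rewrite !mulr_sumr revpoly_sum; apply: eq_bigr => b _.
have an : (a <= n)%N by rewrite -ltnS.
have bn : (b <= n')%N by rewrite -ltnS.
rewrite -!scalerAl -!scalerAr !revpolyZ -!exprD !revpolyXn ?leq_add //.
rewrite -scalerAl -scalerAr -exprD; congr (_ *: (_ *: 'X^_)).
by rewrite -{1}(subnKC an) -{1}(subnKC bn) addnACA addKn.
Qed.

Lemma mul_scale2 a b P P' : (a * b) *: (P * P') = (a *: P) * (b *: P').
Proof. by rewrite -scalerAr -!scalerAl scalerA mulrC. Qed.

(** The two series f = Psi^+(z) and g = Psi^-(z) with the denominator P(c z)
    cleared; the second identity, in powers of 1/z, is multiplied by the power
    of 1/z that turns the Laurent polynomials P(c z) and P(z/c) into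
    polynomials in 1/z. *)
Definition drinfeld c P (f g : nat -> F) :=
  [/\ P.[0] = 1,
    series_eq (dilate c P) f (c ^+ (size P).-1 *: dilate c^-1 P) &
    series_eq (revpoly (size P).-1 (dilate c P)) g
      (c ^+ (size P).-1 *: revpoly (size P).-1 (dilate c^-1 P))].

Lemma horner0_neq0 P : P.[0] = 1 -> P != 0.
Proof.
move=> P1; apply: contra_eq_neq P1 => ->.
by rewrite horner0 eq_sym oner_eq0.
Qed.

Lemma drinfeld_mul c P f g P' f' g' : drinfeld c P f g -> drinfeld c P' f' g' ->
  drinfeld c (P * P') (conv f f') (conv g g').
Proof.
move=> [P1 ef eg] [P'1 ef' eg'].
have [P0 P'0] := (horner0_neq0 P1, horner0_neq0 P'1).
have sz : (size (P * P')).-1 = ((size P).-1 + (size P').-1)%N.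
  rewrite size_mul // -!subn1; move: P0 P'0; rewrite -!size_poly_gt0.
  by case: (size P) (size P') => // m [] // n _ _; rewrite !subn1 addSn addnS.
have szl c0 (Q : {poly F}) : Q != 0 -> (size (dilate c0 Q) <= (size Q).-1.+1)%N.
  by move=> Q0; rewrite prednK ?size_poly_gt0 // size_dilate.
split; first by rewrite hornerM P1 P'1 mulr1.
  rewrite sz exprD !dilateM mul_scale2.
  exact: series_eq_mul.
rewrite sz exprD !dilateM !revpolyM ?szl // mul_scale2.
exact: series_eq_mul.
Qed.

Lemma drinfeld_ext c P f g f' g' : f =1 f' -> g =1 g' ->
  drinfeld c P f g -> drinfeld c P f' g'.
Proof. by move=> /funext -> /funext ->. Qed.
End Series.

Lemma is_drinfeldP (F : fieldType) (d : qaff_datum F) (L : lweight d)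
    (P : 'I_(rk d) -> {poly F}) :
  is_drinfeld L P <->
  forall i, drinfeld (qi d i) (P i) (lpsi L true i) (lpsi L false i).
Proof.
have plus (Q : {poly F}) f (c : F) :
    (forall m : nat, \sum_(a < m.+1) Q`_a * c ^+ a * f (m - a)%N =
       c ^+ (size Q).-1 * (Q`_m * c ^- m)) <->
    series_eq (dilate c Q) f (c ^+ (size Q).-1 *: dilate c^-1 Q).
  split=> e m; have := e m; rewrite coefZ coef_dilate exprVn => <-;
  by apply: eq_bigr => a _; rewrite coef_dilate.
have minus (Q : {poly F}) f (c : F) : Q.[0] = 1 ->
    (forall j : int, \sum_(a < size Q | j <= a%:Z)
        Q`_a * c ^+ a * f `|a%:Z - j|%N =
      c ^+ (size Q).-1 * (if 0 <= j then Q`_(`|j|%N) * c ^- `|j|%N else 0)) <->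
    series_eq (revpoly (size Q).-1 (dilate c Q)) f
      (c ^+ (size Q).-1 *: revpoly (size Q).-1 (dilate c^-1 Q)).
  move=> /horner0_neq0; rewrite -size_poly_gt0; set n := (size Q).-1 => Q0.
  have sQ : size Q = n.+1 by rewrite prednK.
  (* the coefficient of z^(n-m), for n the degree of Q, is the coefficient of
     (1/z)^m after reversal; those of z^j with n < j vanish on both sides *)
  have lhs (m : nat) : \sum_(a < size Q | n%:Z - m%:Z <= a%:Z)
      Q`_a * c ^+ a * f `|a%:Z - (n%:Z - m%:Z)%R|%N =
      \sum_(a < m.+1) (revpoly n (dilate c Q))`_a * f (m - a)%N.
    pose G k := Q`_(n - k) * c ^+ (n - k) * f (m - k)%N.
    transitivity (\sum_(k < n.+1 | (k <= m)%N) G k).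
      rewrite sQ (reindex_inj rev_ord_inj) /=.
      apply: eq_big => [k | k km].
        by have := ltn_ord k; rewrite subSS; lia.
      by rewrite subSS /G; congr (_ * f _); have := ltn_ord k; move: km;
        rewrite subSS; lia.
    rewrite (big_ord_widen_cond (m + n).+1 (fun k => k <= m)%N G); last first.
      by rewrite ltnS leq_addl.
    rewrite (big_ord_widen (m + n).+1
      (fun a => (revpoly n (dilate c Q))`_a * f (m - a)%N)); last first.
      by rewrite ltnS leq_addr.
    rewrite big_mkcond [RHS]big_mkcond; apply: eq_bigr => k _.
    rewrite !ltnS coef_revpoly coef_dilate; case: (leqP k n);
      case: (leqP k m) => //=.
    by rewrite mul0r.
  have rhs (m : nat) : c ^+ n * (if 0 <= n%:Z - m%:Z then
        Q`_(`|n%:Z - m%:Z|%N) * c ^- `|n%:Z - m%:Z|%N else 0) =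
      (c ^+ n *: revpoly n (dilate c^-1 Q))`_m.
    rewrite coefZ coef_revpoly coef_dilate exprVn subr_ge0 lez_nat.
    by case: leqP => // mn; rewrite distnEl.
  split=> [e m | e j]; first by rewrite -lhs -rhs; apply: e.
  have [jn | nj] := lerP j n%:Z.
    have -> : j = n%:Z - `|n%:Z - j|%N%:Z by lia.
    by rewrite lhs rhs; apply: e.
  rewrite big1 => [|a ja]; last first.
    by have := leq_trans (ltn_ord a) (eq_leq sQ); lia.
  case: ifP => j0; last by rewrite mulr0.
  rewrite nth_default ?mul0r ?mulr0 // sQ.
  by lia.
split=> [e i | e i]; have [h1 h2 h3] := e i; split=> //.
- exact/plus.
- exact/minus.
- by apply/plus.
- by apply/minus.
Qed.

(** * The fusion module *)

Section Fusion.
Variables (F : fieldType) (d : qaff_datum F).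
Local Notation I := 'I_(rk d).
Local Notation Fu := (Fu F).
Local Notation u := (uvar F).
Local Notation cu := (const_u F).
Local Notation idF := (idfun : {rmorphism F -> F}).
Local Notation tail X := (fun j => X (lift ord0 j)).

(** All weights are lam minus a sum of simple roots, which are independent. *)
Lemma graded_above (K : fieldType) (iota : {rmorphism F -> K}) (M : lmodType K)
    (k : hspace (qreal d) -> M -> M) lam i x : graded iota k lam ->
  wsp iota k (lam + alpha _ i) x -> x = 0.
Proof.
move=> gM wx; apply/eqP/negPn/negP.
move=> /(weight_in_cone (graded_linear gM) (graded_span gM) wx) [n e].
have : cone lam (fun j => n j + (j == i) * 1)%N != lam.
  by apply: (@cone_eq0 _ _ _ _ i); rewrite eqxx addn1.
by rewrite cone_addn -e mulr1n addrK eqxx.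
Qed.

(** The l-weight of v_1 \otimes ... \otimes v_r at u = 1: the generating
    series are multiplied. *)
Fixpoint fusion_lpsi (r : nat) :
    ('I_r.+1 -> lweight d) -> bool -> I -> nat -> F :=
  match r with
  | 0 => fun L => lpsi (L ord0)
  | r'.+1 => fun L b i =>
      conv (lpsi (L ord0) b i) (fusion_lpsi (tail L) b i)
  end.

(** What is proved by induction on the number of factors. Only the actions kX
    of the torus and phiX of the phi^{+-}_{i,+-m} enter: their coproducts are
    finite sums, unlike those of the x^{+-}_{i,r}. *)
Record top_data (X : lmodType Fu) (kX : hspace (qreal d) -> X -> X)
    (phiX : bool -> I -> nat -> X -> X) (lam : weight d) (x : X)
    (a : bool -> I -> nat -> F) : Prop := TopData {
  top_graded : graded cu kX lam;
  top_formP : exists2 f : X -> Fu, top_form cu kX lam f & f x = 1;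
  top_weight : wsp cu kX lam x;
  top_phi : forall b i m,
    exists2 c, has_value c (a b i m) & phiX b i m x = c *: x
}.

Definition conv_unit (m : nat) : F := (m == 0)%:R.

Lemma conv_unitr f : conv f conv_unit = f.
Proof.
apply/funext => m; rewrite /conv (bigD1 ord0) //= subn0 mulr1 big1 ?addr0 //.
by move=> s s0; rewrite /conv_unit -(inj_eq val_inj) /= in s0 *;
  rewrite (negPf s0) mulr0.
Qed.

(** F(u), with the phi acting by the counit, starts the induction. *)
Lemma top_data_trivial : @top_data Fu^o (fun _ x => x)
  (fun b i m x => (m == 0)%:R *: x) 0 1 (fun _ _ => conv_unit).
Proof.
split.
- exact: graded_trivial.
- by exists id => //; exact: top_form_trivial.
- by move=> t; rewrite lfunE qpow0 rmorph1 scale1r.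
- move=> b i m; exists (m == 0)%:R => //.
  by have := value_const (conv_unit m); rewrite rmorph_nat.
Qed.

Section Step.
Variables (V : Fmod d) (L : lweight d) (v : V).
Hypotheses (V_Mod : in_Mod V) (v_high : is_lhighest L v).
Variables (X : lmodType Fu) (kX : hspace (qreal d) -> X -> X).
Variables (phiX : bool -> I -> nat -> X -> X) (lam : weight d) (x : X).
Variable a : bool -> I -> nat -> F.
Hypothesis X_top : top_data kX phiX lam x a.
Variables (T : lmodType Fu) (pr : V -> X -> T).
Hypothesis prT : is_tensor cu pr.
Variables (k : hspace (qreal d) -> T -> T) (phi : bool -> I -> nat -> T -> T).
Hypothesis k_linear : forall t, linear (k t).
Hypothesis k_pure : forall t y z,
  k t (pr y z) = pr (Uact (Uk d t) y) (kX t z).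
Hypothesis phi_pure : forall b i m y z,
  phi b i m (pr y z) = \sum_(s < m.+1) u ^ (sgb b * s%:Z) *:
    pr (Uact (Uphi d b i (m - s)) y) (phiX b i s z).

(** In the coproduct of phi_{i,m}, each term contributes the scalar
    u^(+-s) Psi_{i,m-s} c_s, and u^(+-s) has the value 1 at u = 1. *)
Lemma top_data_tensor : top_data k phi (lwt L + lam) (pr v x)
  (fun b i => conv (lpsi L b i) (a b i)).
Proof.
have g0 := lh_graded V_Mod v_high; have [f tf fv] := lh_top_form v_high.
have [f' tf' f'v] := top_formP X_top.
split.
- have gT := graded_tensor prT k_linear k_pure.
  exact: gT _ _ g0 (top_graded X_top).
- have [e te eE] := top_form_tensor prT k_linear k_pure tf tf'.
  by exists e => //; rewrite eE fv f'v rmorph1 mul1r.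
- have wv : wsp idF (fun t (y : V) => Uact (Uk d t) y) (lwt L) v.
    exact: lh_weight v_high.
  have vw := wsp_pure prT k_pure wv; exact: vw _ _ (top_weight X_top).
move=> b i m.
have ex s : exists c, has_value c (a b i s) /\ phiX b i s x = c *: x.
  by have [c ca cx] := top_phi X_top b i s; exists c.
have [c hc] := choice ex.
exists (\sum_(s < m.+1) u ^ (sgb b * s%:Z) * (cu (lpsi L b i (m - s)) * c s)).
  apply: value_sum => s; rewrite -[_ * a _ _ _]mul1r.
  apply: valueM; first exact: value_expu.
  by apply: valueM; [exact: value_const | exact: (hc s).1].
rewrite phi_pure scaler_suml; apply: eq_bigr => s _.
by rewrite (lh_phi v_high) (hc s).2 (tensZl prT) (tensZr prT) !scalerA -mulrA.
Qed.
End Step.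

Lemma fusion_top r (V : 'I_r.+1 -> Fmod d) (L : 'I_r.+1 -> lweight d)
    (v : forall j, V j) (act : Uq d -> fspace V -> fspace V) :
  (forall j, in_Mod (V j)) -> (forall j, is_lhighest (L j) (v j)) ->
  is_fusion act ->
  top_data (fun t => act (Uk d t)) (fun b i m => act (Uphi d b i m))
    (\sum_j lwt (L j)) (ptensor v) (fusion_lpsi L).
Proof.
elim: r V L v act => [|r ih] V L v act hM hv hact.
  have lin g : linear (act g) :=
    act_linear (M := UMod (is_fusion_Uaction hact)) g.
  have [_ act_pure] := hact.
  have -> : fusion_lpsi L = (fun b i => conv (lpsi (L ord0) b i) conv_unit).
    by apply/funext => b; apply/funext => i; rewrite conv_unitr.
  have prT :
      is_tensor cu (fun (y : V ord0) (z : Fu^o) => pure cu y z : fspace V).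
    exact: pure_is_tensor.
  rewrite big_ord1 -[lwt _]addr0.
  apply: (top_data_tensor (hM ord0) (hv ord0) top_data_trivial prT) =>
    [t|t y z|b i m y z].
  - exact: lin.
  - exact: act_pure.
  rewrite [LHS]act_pure (bigD1 ord0) //= subn0 mulr0 scale1r scale1r.
  rewrite big1 ?addr0 // => s s0.
  rewrite -(inj_eq val_inj) /= in s0; rewrite (negPf s0) scale0r.
  by rewrite (tens0r prT) scaler0.
have lin g : linear (act g) :=
  act_linear (M := UMod (is_fusion_Uaction hact)) g.
have [_ [act' fact' [_ _ hphi hk]]] := hact.
rewrite big_ord_recl.
have prT : is_tensor cu
    (fun (y : V ord0) (z : fspace (tail V)) => pure cu y z : fspace V).
  exact: pure_is_tensor.
apply: (top_data_tensor (hM ord0) (hv ord0)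
  (ih (tail V) (tail L) (fun j => v (lift ord0 j)) act'
     (fun j => hM (lift ord0 j)) (fun j => hv (lift ord0 j)) fact') prT) =>
  [t|t y z|b i m y z].
- exact: lin.
- exact: hk.
- exact: hphi.
Qed.
End Fusion.

(** * The specialization at u = 1 *)

Lemma seq_dependent (K : fieldType) (M : lmodType K) (s : seq M)
    (x : 'I_(size s).+1 -> M) :
  (forall l, lspan (fun y => y \in s) (x l)) ->
  exists c : 'I_(size s).+1 -> K, (exists l, c l != 0) /\ \sum_l c l *: x l = 0.
Proof.
move=> hx; have [C hC] := choice (fun l => span_list (hx l)).
pose A := \matrix_(l, k) C l k.
have : kermx A != 0.
  by rewrite -mxrank_eq0 mxrank_ker -lt0n subn_gt0 ltnS rank_leq_col.
rewrite -nz_row_eq0; set c := nz_row _ => c0.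
have /sub_kermxP cA : (c <= kermx A)%MS by exact: nz_row_sub.
exists (fun l => c 0 l); split.
  apply: contrapT => nc; move/eqP: c0; apply; apply/rowP => l; rewrite mxE.
  by apply/eqP/negPn/negP => cl; apply: nc; exists l.
under eq_bigr do rewrite hC scaler_sumr.
rewrite exchange_big big1 // => k _; under eq_bigr do rewrite scalerA.
rewrite -scaler_suml; have := congr1 (fun B : 'rV_(size s) => B 0 k) cA.
rewrite !mxE => cA0; suff -> : \sum_l c 0 l * C l k = 0 by rewrite scale0r.
by rewrite -[RHS]cA0; apply: eq_bigr => l _; rewrite mxE.
Qed.

(** A maximal independent family in S is a basis of S. *)
Lemma fin_dim_of_dependent (K : fieldType) (M : lmodType K)
    (S : submodule M) n :
  (forall x : 'I_n.+1 -> M, (forall l, S (x l)) ->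
    exists c : 'I_n.+1 -> K, (exists l, c l != 0) /\ \sum_l c l *: x l = 0) ->
  exists m (b : 'I_m -> M), (forall l, S (b l)) /\
    forall x, S x -> exists c : 'I_m -> K, x = \sum_l c l *: b l.
Proof.
elim: n => [|n ih] dep.
  exists 0%N, (fun=> 0); split=> [l | x Sx]; first exact: submod0.
  exists (fun=> 0); rewrite big_ord0;
    have [c [[l cl]]] := dep (fun=> x) (fun=> Sx).
  have l0 : l = ord0 by exact: ord1.
  by rewrite big_ord1 -l0 => /eqP; rewrite scaler_eq0 (negPf cl) => /eqP.
have [/ih // | ] := pselect (forall x : 'I_n.+1 -> M, (forall l, S (x l)) ->
    exists c : 'I_n.+1 -> K, (exists l, c l != 0) /\ \sum_l c l *: x l = 0).
move=> /existsNP [b /not_implyP [Sb nb]]; exists n.+1, b; split=> // x Sx.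
pose y l := if unlift ord0 l is Some k then b k else x.
have Sy l : S (y l) by rewrite /y; case: unliftP.
have [c [[l cl]]] := dep y Sy.
rewrite big_ord_recl /y unlift_none.
under eq_bigr do rewrite liftK.
have [c0 | c0 e] := eqVneq (c ord0) 0.
  rewrite c0 scale0r add0r => e; case: nb; exists (fun k => c (lift ord0 k)).
  split=> //; case: (unliftP ord0 l) cl => [k -> | -> ]; first by exists k.
  by rewrite c0 eqxx.
exists (fun k => - (c ord0)^-1 * c (lift ord0 k)).
under eq_bigr do rewrite -scalerA.
rewrite -scaler_sumr; move/eqP: e; rewrite addrC addr_eq0 => /eqP ->.
by rewrite scalerN scaleNr opprK scalerA mulVf // scale1r.
Qed.

Section Specialization.
Variables (F : fieldType) (d : qaff_datum F) (W : Umod d (const_u F)) (v : W).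
Local Notation I := 'I_(rk d).
Local Notation cu := (const_u F).
Local Notation inA := (@in_A F).
Local Notation kact := (fun t (x : W) => Uact (Uk d t) x).
Local Notation L := (lattice_mod v).
Local Notation W1 := (special v).
Local Notation wval z := (subspace_val (z : L) : W).
Local Notation cls := (lquot_pi (um1 v) : L -> W1).

Variables (lam : weight d) (a : bool -> I -> nat -> F).
Hypothesis W_top :
  @top_data F d W kact (fun b i m => Uact (Uphi d b i m)) lam v a.

Lemma cls_surj (x : W1) : exists z, x = cls z.
Proof. by exists (repr (x : Quotient.quot _)); exact: esym (lquot_piK x). Qed.

Lemma cls_eq0 z : cls z = 0 -> um1 v z.
Proof.
by rewrite -[RHS](linear0 (lquot_pi (um1 v))) => /lquot_piP; rewrite subr0.
Qed.

Lemma act_cls g z : Uact g (cls z) = cls (Uact g z).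
Proof. exact: (Uquot_actE (@um1_stable F d W v) g z). Qed.

Lemma lattice_A c (x : W) : inA c -> lattice v x -> lattice v (c *: x).
Proof.
move=> Ac [s [hs ->]]; exists [seq (c * p.1, p.2) | p <- s]; split.
  by move=> p /mapP [p' /hs hp' ->]; apply: in_AM.
by rewrite big_map scaler_sumr; apply: eq_bigr => p _; rewrite scalerA.
Qed.

Lemma lattice_gen g : lattice v (Uact g v).
Proof.
exists [:: (1, g)]; rewrite big_seq1 scale1r; split=> // p;
  rewrite inE => /eqP -> /=.
by rewrite -(rmorph1 cu); exact: in_A_const.
Qed.

(** x^+_{i,r} v would have a weight above lam. *)
Lemma top_raise i r : Uact (Ux d true i r) v = 0.
Proof.
apply: (graded_above (i := i) (top_graded W_top)).
exact: wsp_raise (top_weight W_top).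
Qed.

Lemma lattice_word_span (x : W) : lattice v x -> word_span inA v x.
Proof.
have AC := @in_A_const F; have AD := @in_AD F; have AM := @in_AM F.
move=> [s [hs ->]]; elim: s hs => [|p s ih] hs; first by rewrite big_nil; left.
rewrite big_cons; apply: word_spanD; last first.
  by apply: ih => p' p's; apply: hs; rewrite inE p's orbT.
apply: word_spanZ => //; first by apply: hs; rewrite mem_head.
apply: (word_span_gen AC AD AM top_raise (top_weight W_top)) => b i m.
have [c ca e] := top_phi W_top b i m; exists c => //.
by apply/in_A_value; exists (a b i m).
Qed.
End Specialization.

(** The conditions defining the category, for a module whose weights lie in a
    single cone; weights off the cone have zero weight spaces. *)
Section ModCriterion.
Variables (F : fieldType) (d : qaff_datum F) (M : Fmod d) (lam : weight d).
Local Notation I := 'I_(rk d).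
Local Notation idF := (idfun : {rmorphism F -> F}).
Local Notation kact := (fun t (x : M) => Uact (Uk d t) x).
Local Notation wt := (wsp idF kact).

Hypothesis M_span : forall x : M, lspan (fun y => exists n, wt (cone lam n) y)
  x.
Hypothesis M_fin : forall n, exists m (b : 'I_m -> M),
  (forall l, wt (cone lam n) (b l)) /\
  forall x, wt (cone lam n) x -> exists c : 'I_m -> F, x = \sum_l c l *: b l.
Hypothesis M_int : forall (b : nat) (i : I), exists R : nat, forall n : I ->
  nat,
  (forall j, j != i -> (n j <= b)%N) -> (R <= n i)%N ->
  forall x, wt (cone lam n) x -> x = 0.

Let k_lin t : linear (kact t).
Proof. exact: act_linear. Qed.

Let in_cone_wt w (x : M) : wt w x -> x != 0 -> exists n, w = cone lam n.
Proof. exact: weight_in_cone. Qed.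

Lemma in_Mod_criterion : in_Mod M.
Proof.
split.
- move=> x; pose U w y := wt w y.
  have : lspan (fun y => exists w, U w y) x.
    by apply: span_mono (M_span x) => y [n yn]; apply: mem_span;
      exists (cone lam n).
  move=> /span_union [s [hs ->]].
  exists (undup [seq p.1 | p <- s]), (fun w => \sum_(p <- s | p.1 == w) p.2);
    split.
    move=> w; rewrite big_seq_cond.
    apply: (@submod_sum _ _ (wsp_submod idF k_lin w)) => p /andP [ps /eqP <-].
    by apply: span_min (hs p ps).
  rewrite (exchange_big_dep predT) //= [LHS]big_seq [RHS]big_seq.
  apply: eq_bigr => p ps.
  rewrite -big_filter (_ : [seq _ <- _ | _] = [:: p.1]) ?big_seq1 //.
  rewrite (eq_filter (a2 := pred1 p.1)); last by move=> w; rewrite /= eq_sym.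
  by rewrite filter_pred1_uniq ?undup_uniq // mem_undup map_f.
- move=> s f us hf s0 w ws.
  have hp p : p \in [seq (w, f w) | w <- s] -> wt p.1 p.2.
    by move=> /mapP [w' _ ->]; apply: hf.
  have := weight_sum0 k_lin w hp; rewrite !big_map => /(_ s0) /=.
  by rewrite -big_filter filter_pred1_uniq // big_seq1.
- move=> w; have [[n ->] | nw] := pselect (exists n, w = cone lam n);
  first exact: M_fin.
  exists 0%N, (fun=> 0); split=> [[] // | x wx]; exists (fun=> 0);
    rewrite big_ord0.
  apply/eqP/negPn/negP => x0; apply: nw; exact: in_cone_wt wx x0.
- exists [:: lam] => w [x [wx x0]]; exists lam; rewrite ?mem_head //.
  by have [n e] := in_cone_wt wx x0; exists n.
move=> w i.
(* w + r alpha_i leaves the cone for large r; if it never meets the cone, there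
   is nothing to prove *)
have raise : exists R, forall r, (R <= r)%N -> forall x : M,
    wt (w + (alpha (qreal d) i : weight d) *+ r) x -> x = 0.
  have [[r0 [n0 e0]] | ne] := pselect (exists r0 n0,
      w + (alpha (qreal d) i : weight d) *+ r0 = cone lam n0); last first.
    exists 0%N => r _ x wx; apply/eqP/negPn/negP => x0; apply: ne; exists r.
    exact: in_cone_wt wx x0.
  exists (r0 + (n0 i).+1)%N => r rR x wx; apply/eqP/negPn/negP => x0.
  have [n e] := in_cone_wt wx x0.
  have : cone lam (fun j => n j + (j == i) * (r - r0))%N = cone lam n0.
    rewrite cone_addn -e -e0; apply/eqP;
      rewrite subr_eq -addrA -mulrnDr subnKC //.
    exact: leq_trans (leq_addr _ _) rR.
  move=> /cone_inj /(_ i); rewrite eqxx mul1n => ni.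
  have : (n0 i < r - r0)%N by rewrite ltn_subRL -addnS.
  by rewrite -ni ltnNge leq_addl.
(* from the first r0 on, w - r alpha_i stays in the cone, and the coefficients
   of the other simple roots stay constant *)
have lower : exists R, forall r, (R <= r)%N -> forall x : M,
    wt (w - (alpha (qreal d) i : weight d) *+ r) x -> x = 0.
  have [[r0 [n0 e0]] | ne] := pselect (exists r0 n0,
      w - (alpha (qreal d) i : weight d) *+ r0 = cone lam n0); last first.
    exists 0%N => r _ x wx; apply/eqP/negPn/negP => x0; apply: ne; exists r.
    exact: in_cone_wt wx x0.
  have [R hR] := M_int (\max_j n0 j) i.
  exists (r0 + R)%N => r rR x wx.
  have r0r : (r0 <= r)%N by exact: leq_trans (leq_addr _ _) rR.
  apply: (hR (fun j => n0 j + (j == i) * (r - r0))%N).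
  - by move=> j /negPf ->; rewrite addn0; apply: leq_bigmax.
  - rewrite eqxx mul1n; apply: leq_trans (leq_addl _ _); by rewrite leq_subRL.
  by rewrite cone_addn -e0 -addrA -opprD -mulrnDr subnKC.
have [R hR] := raise; have [R' hR'] := lower.
exists (R + R')%N => r rR x; split; [apply: hR | apply: hR'];
  apply: leq_trans rR; [exact: leq_addr | exact: leq_addl].
Qed.
End ModCriterion.

Section SpecialModule.
Variables (F : fieldType) (d : qaff_datum F) (W : Umod d (const_u F)) (v : W).
Local Notation I := 'I_(rk d).
Local Notation u := (uvar F).
Local Notation cu := (const_u F).
Local Notation inA := (@in_A F).
Local Notation idF := (idfun : {rmorphism F -> F}).
Local Notation kact := (fun t (x : W) => Uact (Uk d t) x).
Local Notation L := (lattice_mod v).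
Local Notation W1 := (special v).
Local Notation wval z := (subspace_val (z : L) : W).
Local Notation cls := (lquot_pi (um1 v) : L -> W1).
Local Notation v1 := (special_vec v).
Local Notation kact1 := (fun t (x : W1) => Uact (Uk d t) x).

Variables (lam : weight d) (a : bool -> I -> nat -> F).
Hypothesis W_top :
  @top_data F d W kact (fun b i m => Uact (Uphi d b i m)) lam v a.

Lemma lattice_sub (x : W) : lattice v x -> exists z : L, wval z = x.
Proof.
move=> hx; have hx' : (x : Urestrict W) \in submod_pred (lattice v).
  exact/asboolP.
by exists (Subspace hx').
Qed.

Lemma lattice_val (z : L) : lattice v (wval z).
Proof. by apply/asboolP; case: z. Qed.

Lemma wvalP (z z' : L) : wval z = wval z' -> z = z'.
Proof. by move=> e; apply: val_inj; exact: e. Qed.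

Lemma clsD z z' : cls (z + z') = cls z + cls z'. Proof. exact: linearD. Qed.
Lemma clsZ c z : cls (c *: z) = c *: cls z. Proof. exact: linearZ. Qed.
Lemma cls0 : cls 0 = 0. Proof. exact: linear0. Qed.

(** The image of a weight space of the lattice; [wsp_lattice_wspace] shows that
    it is the whole weight space of the specialization. *)
Definition lattice_wspace w (x : W1) :=
  exists z, wsp cu kact w (wval z) /\ x = cls z.

Lemma lattice_wspace_wsp w x : lattice_wspace w x -> wsp idF kact1 w x.
Proof.
move=> [z [wz ->]] t; rewrite act_cls -clsZ; congr (lquot_pi _ _).
by apply: wvalP; exact: wz t.
Qed.

Let kW t : linear (kact t). Proof. exact: act_linear. Qed.
Let kW1 t : linear (kact1 t). Proof. exact: act_linear. Qed.

Lemma lattice_wspace_closed w : [/\ lattice_wspace w 0,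
  forall x y, lattice_wspace w x -> lattice_wspace w y ->
    lattice_wspace w (x + y) &
  forall c x, lattice_wspace w x -> lattice_wspace w (c *: x)].
Proof.
split=> [|x y [z [wz ->]] [z' [wz' ->]]|c x [z [wz ->]]].
- by exists 0; rewrite cls0; split=> //; apply: (wsp0 _ kW).
- exists (z + z'); rewrite clsD; split=> //.
  exact: (wspD kW wz wz').
- exists (c *: z); rewrite clsZ; split=> //.
  exact: (wspZ kW (cu c) wz).
Qed.

Lemma word_span_lattice x : word_span inA v x -> lattice v x.
Proof.
elim=> {x} [|c n x y Ac wx _ ly]; first exact: lattice0.
apply: latticeD ly; apply: lattice_A => //.
by have [g ->] := word_act wx; apply: lattice_gen.
Qed.

Lemma lattice_wspace_span (x : W1) :
  lspan (fun y => exists n, lattice_wspace (cone lam n) y) x.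
Proof.
have [z ->] := cls_surj x.
move: (lattice_word_span W_top (lattice_val z)); move e: (wval z) => y wy.
elim: wy z e => {y} [|c n y y' Ac wy wsy' ih] z e.
  have -> : z = 0 by exact: wvalP.
  by rewrite cls0; apply: submod0.
have [z1 e1] : exists z : L, wval z = c *: y.
  apply: lattice_sub; apply: lattice_A => //.
  by have [g ->] := word_act wy; apply: lattice_gen.
have [z2 e2] := lattice_sub (word_span_lattice wsy').
have -> : z = z1 + z2 by apply: wvalP; rewrite e -e1 -e2.
rewrite clsD; apply: submodD; last exact: ih.
apply: mem_span; exists n, z1; split=> //; rewrite e1.
by apply: (wspZ kW); apply: word_wsp wy; exact: top_weight W_top.
Qed.

(** The lattice is a sum of weight spaces, as its generators g.v are sums of
    words. *)
Lemma wsp_lattice_wspace w x : wsp idF kact1 w x -> lattice_wspace w x.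
Proof.
move=> wx; have [l0 lD lZ] := lattice_wspace_closed w.
have : lspan (fun y => exists w, lattice_wspace w y) x.
  apply: span_mono (lattice_wspace_span x) => y [n yn].
  by apply: mem_span; exists (cone lam n).
move=> /(weight_component kW1 lattice_wspace_wsp) /(_ wx).
exact: (@span_min _ _ _ (Submodule l0 lD lZ)).
Qed.

Lemma special_span (x : W1) :
  lspan (fun y => exists n, wsp idF kact1 (cone lam n) y) x.
Proof.
apply: span_mono (lattice_wspace_span x) => y [n /lattice_wspace_wsp yn].
by apply: mem_span; exists n.
Qed.

Lemma special_int (b : nat) (i : I) : exists R : nat, forall n : I -> nat,
  (forall j, j != i -> (n j <= b)%N) -> (R <= n i)%N ->
  forall x, wsp idF kact1 (cone lam n) x -> x = 0.
Proof.
have [R hR] := graded_int (top_graded W_top) b i; exists R => n nb nR x.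
move=> /wsp_lattice_wspace [z [wz ->]]; rewrite (_ : z = 0) ?cls0 //.
by apply: wvalP; apply: hR nb nR _ wz.
Qed.

(** c - c(1) is u - 1 times a regular fraction. *)
Lemma cls_value c b (z z' : L) : has_value c b -> wval z' = c *: wval z ->
  cls z' = b *: cls z.
Proof.
move=> /value_split [c' Ac' ->] e; rewrite -clsZ; apply/lquot_piP.
have [y ey] := lattice_sub (lattice_A Ac' (lattice_val z)).
exists y; rewrite ey scalerA.
have -> : wval (z' - b *: z) = wval z' - cu b *: wval z by [].
by rewrite e scalerDl addrC addKr.
Qed.

(** A relation over F(u) between lifts, rescaled to be regular and nonzero at
    u = 1, specializes to a relation over F. *)
Lemma special_dependent w (s : seq W)
    (s_span : forall x, wsp cu kact w x -> lspan (fun y => y \in s) x)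
    (x : 'I_(size s).+1 -> W1) : (forall l, wsp idF kact1 w (x l)) ->
  exists c : 'I_(size s).+1 -> F, (exists l, c l != 0) /\ \sum_l c l *: x l = 0.
Proof.
move=> hx; have [z hz] := choice (fun l => wsp_lattice_wspace (hx l)).
have [c [[l0 cl0] c0]] := seq_dependent (fun l => s_span _ (hz l).1).
have [t [b [tb b0]]] := rescale_at1 cl0; exists b; split=> //.
have ex l : exists y : L, wval y = (t * c l) *: wval (z l).
  apply: lattice_sub; apply: lattice_A; last exact: lattice_val.
  by apply/in_A_value; exists (b l).
have [y hy] := choice ex.
transitivity (\sum_l cls (y l)).
  by apply: eq_bigr => l _; rewrite (hz l).2 (cls_value (tb l) (hy l)).
rewrite -(big_morph cls clsD cls0) (_ : \sum_l y l = 0) ?cls0 //.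
apply: wvalP; transitivity (\sum_l wval (y l)).
  exact: (big_morph (fun y : L => wval y) (fun _ _ => erefl) erefl).
under eq_bigr do rewrite hy -scalerA.
by rewrite -scaler_sumr c0 scaler0.
Qed.

Lemma special_in_Mod : in_Mod W1.
Proof.
apply: (in_Mod_criterion special_span _ special_int) => n.
have [s hs] := graded_fin (top_graded W_top) n.
exact: (fin_dim_of_dependent (S := wsp_submod idF kW1 (cone lam n))
  (special_dependent hs)).
Qed.

(** f vanishes on nonempty words and is 1 on the empty one. *)
Lemma top_form_lattice f : top_form cu kact lam f -> f v = 1 ->
  forall x, lattice v x -> inA (f x).
Proof.
move=> tf fv x /(lattice_word_span W_top); elim=> {x} [|c n x y Ac wx _ fy].
  by rewrite (form0 (top_linear tf)) -(rmorph0 cu); apply: in_A_const.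
rewrite (top_linear tf); apply: in_AD fy; apply: in_AM Ac _.
have [n0 | /existsNP [i ni]] := pselect (n =1 (fun=> 0%N)).
  by rewrite (word_top wx n0) fv -(rmorph1 cu); apply: in_A_const.
rewrite (top_form_lower tf (word_wsp (top_weight W_top) wx)).
  by rewrite -(rmorph0 cu); apply: in_A_const.
by apply: (@cone_eq0 _ _ _ _ i); rewrite lt0n; apply/eqP.
Qed.

(** If v = (u - 1) y in the lattice, then 1 = f v = (u - 1) f y with f y regular
    at u = 1. *)
Lemma special_vec_neq0 : v1 != 0.
Proof.
apply/eqP => /cls_eq0 [y e].
have [f tf fv] := top_formP W_top.
have := um1_not_unit (top_form_lattice tf fv (lattice_val y)).
by rewrite -(formZ (top_linear tf)) -e fv eqxx.
Qed.

(** Modulo u - 1, the coefficients in A may be replaced by their values at 1. *)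
Lemma special_gen (x : W1) : exists g, x = Uact g v1.
Proof.
have [z ->] := cls_surj x; have [s [hs e]] := lattice_val z.
elim: s hs z e => [|p s ih] hs z e.
  exists 0; rewrite act0l (_ : z = 0) ?cls0 //.
  by apply: wvalP; rewrite e big_nil.
have Ap : inA p.1 by apply: hs; rewrite mem_head.
have [z1 e1] := lattice_sub (lattice_A Ap (lattice_gen v p.2)).
have hs' p' : p' \in s -> inA p'.1.
  by move=> p's; apply: hs; rewrite inE p's orbT.
have [z2 e2] : exists z2 : L, wval z2 = \sum_(p <- s) p.1 *: Uact p.2 v.
  by apply: lattice_sub; exists s.
have [g eg] := ih hs' z2 e2.
have /in_A_value [b hb] := Ap; exists (b *: p.2 + g).
have -> : z = z1 + z2 by apply: wvalP; rewrite e big_cons -e1 -e2.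
rewrite clsD eg actDl actZl; congr (_ + _).
rewrite [Uact p.2 v1]act_cls.
exact: (@cls_value _ _ (Uact p.2 (lattice_vec v)) z1 hb e1).
Qed.

Lemma special_phi b i m : Uact (Uphi d b i m) v1 = a b i m *: v1.
Proof.
have [c ca e] := top_phi W_top b i m.
rewrite [LHS]act_cls.
exact: (@cls_value _ _ (lattice_vec v)
  (Uact (Uphi d b i m) (lattice_vec v)) ca e).
Qed.

Lemma special_lhighest (L1 : lweight d) : lwt L1 = lam ->
  (forall b i m, lpsi L1 b i m = a b i m) -> is_lhighest L1 v1.
Proof.
move=> e1 ea; split.
- exact: special_vec_neq0.
- rewrite e1; apply: (@lattice_wspace_wsp lam); exists (lattice_vec v);
  split=> //.
  exact: top_weight W_top.
- exact: special_gen.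
- move=> i r; rewrite [LHS]act_cls (_ : Uact _ _ = 0) ?cls0 //.
  by apply: wvalP; exact: top_raise W_top i r.
- by move=> b i m; rewrite ea special_phi.
Qed.

Lemma special_lpsi (L1 : lweight d) b i m :
  is_lhighest L1 v1 -> lpsi L1 b i m = a b i m.
Proof.
move=> h1; apply/eqP; rewrite -subr_eq0.
have : (lpsi L1 b i m - a b i m) *: v1 == 0.
  by rewrite scalerBl -(lh_phi h1) special_phi subrr.
by rewrite scaler_eq0 (negPf special_vec_neq0) orbF.
Qed.
End SpecialModule.

Section TensorWeight.
Variables (F : fieldType) (d : qaff_datum F).

Lemma conv0 (f g : nat -> F) : conv f g 0 = f 0%N * g 0%N.
Proof. by rewrite /conv big_ord1. Qed.

Lemma fusion_lpsi0 r (L : 'I_r.+1 -> lweight d) b i : fusion_lpsi L b i 0 =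
  qpow (qpar d) ((sgb b)%:~R * (symmz i)%:R *
    (\sum_j lwt (L j)) (alphav (qreal d) i)).
Proof.
elim: r L => [|r ih] L; first by rewrite big_ord1 /= lpsi0.
by rewrite /= conv0 ih lpsi0 -qpowD -mulrDr [in RHS]big_ord_recl add_lfunE.
Qed.

Lemma sum_integral r (L : 'I_r.+1 -> lweight d) :
  is_integral (\sum_j lwt (L j)).
Proof.
move=> i; rewrite sum_lfunE; apply: rpred_sum => j _; exact: lwt_integral.
Qed.

Lemma fusion_drinfeld r (L : 'I_r.+1 -> lweight d)
    (P : 'I_r.+1 -> 'I_(rk d) -> {poly F}) :
  (forall j, is_drinfeld (L j) (P j)) ->
  forall i, drinfeld (qi d i) (\prod_j P j i) (fusion_lpsi L true i)
    (fusion_lpsi L false i).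
Proof.
elim: r L P => [|r ih] L P hP i.
  by rewrite big_ord1; apply: (is_drinfeldP (L ord0) (P ord0)).1.
rewrite big_ord_recl; apply: drinfeld_mul.
  exact: (is_drinfeldP (L ord0) (P ord0)).1.
exact: (ih (fun j => L (lift ord0 j)) (fun j => P (lift ord0 j))).
Qed.
End TensorWeight.

Theorem special_fusion (F : fieldType) (d : qaff_datum F) (r : nat)
  (V : 'I_r.+1 -> Fmod d) (v : forall j, V j) (L : 'I_r.+1 -> lweight d)
  (P : 'I_r.+1 -> 'I_(rk d) -> {poly F})
  (V_Mod : forall j, in_Mod (V j))
  (v_lhighest : forall j, is_lhighest (L j) (v j))
  (P_drinfeld : forall j, is_drinfeld (L j) (P j))
  (W : fusion_module V) :
  let W1 : Fmod d := special (ptensor v : W) in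
  let v1 : W1 := special_vec (ptensor v : W) in
  (in_Mod W1 /\ exists L1 : lweight d, is_lhighest L1 v1) /\
  (forall L1 : lweight d, is_lhighest L1 v1 ->
     is_drinfeld L1 (fun i => \prod_j P j i)).
Proof.
move=> W1 v1; have W_top := fusion_top V_Mod v_lhighest (fusion_axiom W).
split; first split.
- exact: (special_in_Mod (W := W)) W_top.
- pose L1 := LWeight (sum_integral L) (fusion_lpsi0 L); exists L1.
  apply: (@special_lhighest F d W (ptensor v) _ _ W_top L1) => //.
move=> L1 hL1; apply/is_drinfeldP => i.
have e b m : fusion_lpsi L b i m = lpsi L1 b i m.
  exact: esym (special_lpsi (W := W) W_top b i m hL1).
exact: drinfeld_ext (e true) (e false) (fusion_drinfeld P_drinfeld i).
Qed.

Theorem corollary4p9 (R : realType) (d : qaff_datum R[i]) (r : nat)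
  (V : 'I_r.+1 -> Fmod d) (v : forall j, V j) (L : 'I_r.+1 -> lweight d)
  (P : 'I_r.+1 -> 'I_(rk d) -> {poly R[i]})
  (V_Mod : forall j, in_Mod (V j))
  (v_lhighest : forall j, is_lhighest (L j) (v j))
  (P_drinfeld : forall j, is_drinfeld (L j) (P j))
  (W : fusion_module V) :
  let W1 : Fmod d := special (ptensor v : W) in
  let v1 : W1 := special_vec (ptensor v : W) in
  (in_Mod W1 /\ exists L1 : lweight d, is_lhighest L1 v1) /\
  (forall L1 : lweight d, is_lhighest L1 v1 ->
     is_drinfeld L1 (fun i => \prod_j P j i)).
Proof. exact: (special_fusion V_Mod v_lhighest P_drinfeld). Qed.
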